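(* Let $(M^3,g)$ be a connected 3-dimensional Riemannian manifold on which the multiplicities of the principal Ricci curvatures are constant. Then $(M^3,g)$ is Deszcz symmetric if and only if it is a real space form or it is a quasi space form.
   Context: Principal Ricci curvatures: the eigenvalues (with respect to $g$) of the Ricci tensor $S(X,Y)=\sum_t R(X,E_t,E_t,Y)$, $E_1,\dots,E_n$ any orthonormal tangent frame. Their multiplicities are constant if the number of distinct eigenvalues and their multiplicities are the same at all points. Curvature conventions: $R(X,Y)=\nabla_X\nabla_Y-\nabla_Y\nabla_X-\nabla_{[X,Y]}$, $R(X,Y,V,W)=g(R(X,Y)V,W)$, $(X\wedge_g Y)V=g(Y,V)X-g(X,V)Y$. The sectional curvature of the plane spanned by orthonormal $v,w$ is $K(v\wedge w)=R(v,w,w,v)$. The $(0,6)$ tensors $R\cdot R$ and $\wedge_g\cdot R$ (Tachibana tensor) are obtained by letting $R(X,Y)$, respectively $X\wedge_g Y$, act as a derivation on the $(0,4)$ tensor $R$: for $A=R(X,Y)$, respectively $A=X\wedge_g Y$, the value at $(V_1,V_2,V_3,V_4;X,Y)$ is $-R(AV_1,V_2,V_3,V_4)-R(V_1,AV_2,V_3,V_4)-R(V_1,V_2,AV_3,V_4)-R(V_1,V_2,V_3,AV_4)$. Deszcz symmetric: there is a function $L:M\to\mathbb{R}$ with $R\cdot R=L\,(\wedge_g\cdot R)$. Real space form: there is one real number $c$ such that $K(\tilde\pi)=c$ for all tangent 2-planes $\tilde\pi$ at all points. Quasi space form: in general a $(q)$ quasi space form of dimension $n\ge 3$ has distributions of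 dimensions $q$ and $n-q\ge q\geq 1$, so in dimension $n=3$ only $q=1$ occurs. $(M^3,g)$ is a quasi space form if it admits two orthogonally complementary distributions $D$ and $D^\perp$ with $TM=D\oplus D^\perp$, of dimensions $1$ and $2$, and real functions $\overline{K},K^\perp$ on $M$, distinct at every point, such that for all orthonormal $X\in D$, $X^\perp,Y^\perp\in D^\perp$ (at any point) and all $\theta\in[0,\pi/2]$, the plane $\tilde\pi=(X\cos\theta+X^\perp\sin\theta)\wedge Y^\perp$ satisfies $K(\tilde\pi)=\overline{K}\cos^2\theta+K^\perp\sin^2\theta$. *)

(* Defs.v *)
From HB Require Import structures.
From mathcomp Require Import all_boot all_order all_algebra.
From mathcomp Require Import all_classical all_reals all_analysis.

Set Implicit Arguments.
Unset Strict Implicit.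
Unset Printing Implicit Defensive.

Import Order.TTheory GRing.Theory Num.Theory.
Import numFieldNormedType.Exports.

Local Open Scope classical_set_scope.
Local Open Scope ring_scope.

(* Tangent vectors at p are given by their coordinates (row vectors) in a
   chart c around p; every tensorial notion below is computed in a chart, at the point of coordinates
   x = chart_map c p, and every pointwise condition is required in all charts
   around p.  Vectors change chart by the differential of the transition map. *)

Section Smooth.
Context {R : realType} {V W : normedModType R}.

(* C^k on an open set U: differentiable there, with C^(k-1) differential
   (tested on each vector; this is the usual notion since V will be R^n). *)
Fixpoint Ck_on (U : set V) (k : nat) (f : V -> W) : Prop :=
  if k is k'.+1 then
    (forall x, U x -> differentiable f x) /\
    (forall v, Ck_on U k' ('D_v f))
  else forall x, U x -> {for x, continuous f}.

Definition smooth_on (U : set V) (f : V -> W) := forall k, Ck_on U k f.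

End Smooth.

Record smooth_manifold (R : realType) (n : nat) (M : topologicalType) := {
  chart : Type;
  chart_dom : chart -> set M;
  chart_map : chart -> M -> 'rV[R]_n;
  chart_inv : chart -> 'rV[R]_n -> M;
  mfd_hausdorff : hausdorff_space M;
  mfd_second_countable : @second_countable M;
  chart_dom_cover : forall p, exists c, chart_dom c p;
  chart_dom_open : forall c, open (chart_dom c);
  chart_map_open : forall c, open (chart_map c @` chart_dom c);
  chart_mapK : forall c p, chart_dom c p -> chart_inv c (chart_map c p) = p;
  chart_map_continuous : forall c p, chart_dom c p ->
    {for p, continuous (chart_map c)};
  chart_inv_continuous : forall c p, chart_dom c p ->
    {for chart_map c p, continuous (chart_inv c)};
  transition_smooth : forall c c',
    smooth_on (chart_map c @` (chart_dom c `&` chart_dom c'))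
      (chart_map c' \o chart_inv c) }.

Section Geometry.
Context {R : realType} {n : nat} {M : topologicalType}.

Definition image_of (A : smooth_manifold R n M) (c : chart A) : set 'rV[R]_n :=
  chart_map c @` chart_dom c.

Definition transition (A : smooth_manifold R n M) (c c' : chart A) :
  'rV[R]_n -> 'rV[R]_n := chart_map c' \o chart_inv c.

Definition bilin (G : 'M[R]_n) (u v : 'rV[R]_n) : R := (u *m G *m v^T) 0 0.

(* gram c x is the matrix (g_ij) of g in the chart c at the point of
   coordinates x *)
Record riemannian_metric (A : smooth_manifold R n M) := {
  gram : chart A -> 'rV[R]_n -> 'M[R]_n;
  gram_smooth : forall c, smooth_on (image_of c) (gram c);
  gram_sym : forall c x, image_of c x -> (gram c x)^T = gram c x;
  gram_pos : forall c x, image_of c x ->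
    forall v : 'rV[R]_n, v != 0 -> 0 < bilin (gram c x) v v;
  gram_transition : forall c c' p, chart_dom c p -> chart_dom c' p -> forall u v,
    bilin (gram c (chart_map c p)) u v =
    bilin (gram c' (chart_map c' p))
      ('d (transition c c') (chart_map c p) u)
      ('d (transition c c') (chart_map c p) v) }.

(* A smooth rank q subbundle of TM: the fibre over a point is the
   row space of fibre c x, and it is locally spanned by q smooth vector fields. *)
Record smooth_distribution (A : smooth_manifold R n M) (q : nat) := {
  fibre : chart A -> 'rV[R]_n -> 'M[R]_n;
  fibre_rank : forall c x, image_of c x -> \rank (fibre c x) = q;
  fibre_transition : forall c c' p, chart_dom c p -> chart_dom c' p -> forall v,
    (v <= fibre c (chart_map c p))%MS =
    ('d (transition c c') (chart_map c p) v <= fibre c' (chart_map c' p))%MS;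
  fibre_smooth : forall c x, image_of c x ->
    exists (U : set 'rV[R]_n) (F : 'I_q -> 'rV[R]_n -> 'rV[R]_n),
      [/\ open U, U x, U `<=` image_of c,
          (forall i, smooth_on U (F i)) &
          (forall y, U y -> (fibre c y == \matrix_(i < q) F i y)%MS)] }.

Section Curvature.
Context {A : smooth_manifold R n M} (g : riemannian_metric A) (c : chart A).

Definition inner (x : 'rV[R]_n) (u v : 'rV[R]_n) : R := bilin (gram g c x) u v.

(* Vector fields on the domain of the chart c; only values on image_of c are
   meaningful. *)
Local Notation vfield := ('rV[R]_n -> 'rV[R]_n).

(* partial_i g_jl *)
Definition partial_gram (i j l : 'I_n) (x : 'rV[R]_n) : R :=
  'D_(delta_mx 0 i) (fun y => gram g c y j l) x.

Definition christoffel (k i j : 'I_n) (x : 'rV[R]_n) : R :=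
  2^-1 * \sum_(l < n) invmx (gram g c x) k l *
    (partial_gram i j l x + partial_gram j i l x - partial_gram l i j x).

(* Levi-Civita connection in coordinates:
   (nabla_X Y)^k = X(Y^k) + Gamma^k_ij X^i Y^j *)
Definition nabla (X Y : vfield) : vfield := fun x =>
  'D_(X x) Y x +
  \row_k \sum_(i < n) \sum_(j < n) christoffel k i j x * X x 0 i * Y x 0 j.

Definition lie_bracket (X Y : vfield) : vfield := fun x =>
  'D_(X x) Y x - 'D_(Y x) X x.

Definition curv_field (X Y V : vfield) : vfield := fun x =>
  nabla X (nabla Y V) x - nabla Y (nabla X V) x - nabla (lie_bracket X Y) V x.

(* R(X,Y)V is tensorial: its value on tangent vectors is obtained by extending
   them to vector fields, here with constant coordinates. *)
Definition curv_op (x : 'rV[R]_n) (X Y V : 'rV[R]_n) : 'rV[R]_n :=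
  curv_field (cst X) (cst Y) (cst V) x.

Definition curv (x : 'rV[R]_n) (X Y V W : 'rV[R]_n) : R :=
  inner x (curv_op x X Y V) W.

Definition wedge_op (x : 'rV[R]_n) (X Y V : 'rV[R]_n) : 'rV[R]_n :=
  inner x Y V *: X - inner x X V *: Y.

Definition act_on_curv (x : 'rV[R]_n) (B : 'rV[R]_n -> 'rV[R]_n)
    (V1 V2 V3 V4 : 'rV[R]_n) : R :=
  - curv x (B V1) V2 V3 V4 - curv x V1 (B V2) V3 V4
  - curv x V1 V2 (B V3) V4 - curv x V1 V2 V3 (B V4).

Definition R_dot_R (x : 'rV[R]_n) (V1 V2 V3 V4 X Y : 'rV[R]_n) : R :=
  act_on_curv x (curv_op x X Y) V1 V2 V3 V4.

Definition tachibana (x : 'rV[R]_n) (V1 V2 V3 V4 X Y : 'rV[R]_n) : R :=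
  act_on_curv x (wedge_op x X Y) V1 V2 V3 V4.

Definition orthonormal_family (x : 'rV[R]_n) (s : seq 'rV[R]_n) : Prop :=
  forall i j, (i < size s)%N -> (j < size s)%N ->
    inner x s`_i s`_j = (i == j)%:R.

(* Sectional curvature of the plane spanned by v, w, for orthonormal v, w *)
Definition sec (x : 'rV[R]_n) (v w : 'rV[R]_n) : R := curv x v w w v.

Definition ricci (x : 'rV[R]_n) (E : n.-tuple 'rV[R]_n) (X Y : 'rV[R]_n) : R :=
  \sum_(t < n) curv x X (tnth E t) (tnth E t) Y.

(* For an orthonormal frame E, g has the identity matrix in E, so that the
   eigenvalues of S with respect to g are those of this matrix. *)
Definition ricci_mx (x : 'rV[R]_n) (E : n.-tuple 'rV[R]_n) : 'M[R]_n :=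
  \matrix_(i, j) ricci x E (tnth E i) (tnth E j).

End Curvature.

Context {A : smooth_manifold R n M} (g : riemannian_metric A).

(* At all points, the same number r of distinct eigenvalues lam a,
   with the same multiplicities m a *)
Definition constant_ricci_multiplicities : Prop :=
  exists (r : nat) (m : 'I_r -> nat),
  forall (c : chart A) (p : M) (E : n.-tuple 'rV[R]_n),
    chart_dom c p -> orthonormal_family g c (chart_map c p) E ->
    exists lam : 'I_r -> R,
      [/\ injective lam,
          (forall t, eigenvalue (ricci_mx g c (chart_map c p) E) t <->
                     exists a, t = lam a) &
          (forall a,
             \rank (eigenspace (ricci_mx g c (chart_map c p) E) (lam a)) = m a)].

Definition deszcz_symmetric : Prop :=
  exists L : M -> R, forall (c : chart A) (p : M), chart_dom c p ->
    forall V1 V2 V3 V4 X Y : 'rV[R]_n,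
      R_dot_R g c (chart_map c p) V1 V2 V3 V4 X Y =
      L p * tachibana g c (chart_map c p) V1 V2 V3 V4 X Y.

Definition real_space_form : Prop :=
  exists k : R, forall (c : chart A) (p : M), chart_dom c p ->
    forall v w : 'rV[R]_n, orthonormal_family g c (chart_map c p) [:: v; w] ->
      sec g c (chart_map c p) v w = k.

End Geometry.

Definition quasi_space_form (R : realType) (M : topologicalType)
    (A : smooth_manifold R 3 M) (g : riemannian_metric A) : Prop :=
  exists (D : smooth_distribution A 1) (Dp : smooth_distribution A 2)
    (Kbar Kperp : M -> R),
    [/\ (forall p, Kbar p != Kperp p),
        (forall (c : chart A) (p : M), chart_dom c p ->
           mxdirect (fibre D c (chart_map c p) + fibre Dp c (chart_map c p)) /\
           (fibre D c (chart_map c p) + fibre Dp c (chart_map c p) == 1%:M)%MS),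
        (forall (c : chart A) (p : M), chart_dom c p -> forall X Y : 'rV[R]_3,
           (X <= fibre D c (chart_map c p))%MS -> (Y <= fibre Dp c (chart_map c p))%MS ->
           inner g c (chart_map c p) X Y = 0) &
        (forall (c : chart A) (p : M), chart_dom c p -> forall X Xp Yp : 'rV[R]_3,
           (X <= fibre D c (chart_map c p))%MS ->
           (Xp <= fibre Dp c (chart_map c p))%MS ->
           (Yp <= fibre Dp c (chart_map c p))%MS ->
           orthonormal_family g c (chart_map c p) [:: X; Xp; Yp] ->
           forall theta : R, 0 <= theta <= pi / 2 ->
             sec g c (chart_map c p) (cos theta *: X + sin theta *: Xp) Yp =
             Kbar p * cos theta ^+ 2 + Kperp p * sin theta ^+ 2)].

(* Main.v *)
Require Import Defs.
From HB Require Import structures.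
From mathcomp Require Import all_boot all_order all_algebra.
From mathcomp Require Import all_classical all_reals all_analysis.
From mathcomp Require Import ring lra.

(** In dimension 3 the curvature tensor at a point is determined by a symmetric
    operator B on bivectors, and bivectors are identified with vectors by the
    cross product; the Ricci form is then [\tr B - B]. The endomorphism R(X,Y) is
    the infinitesimal rotation about B(X x Y), up to sign, and the wedge of X and Y
    that about X x Y, so that R.R and the Tachibana tensor are both obtained by
    letting a rotation act on B. Since rotations preserve the dot product, the
    equation R.R = L Q(g,R) at a point says that every rotation about a vector of
    the image of C = B - L annihilates C. This forces the adjugate of C to be a
    scalar, hence C to be a scalar or of rank one ([rotate_alternative]). In terms
    of the Ricci operator: it is a scalar, or it has the simple eigenvalue 2L and
    a double one different from 2L ([deszcz_at_alternative]).

    If the multiplicities are constant, one of the two cases holds at all points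
    ([umbilic_multiplicity]). In the first one the sectional curvature is a
    function of the point, and it is constant by Schur's lemma
    ([derive_scal_eq0]), which follows from the second Bianchi identity and
    connectedness. In the second one the two eigenspaces of the Ricci operator
    are orthogonal distributions; they are smooth because the projectors on them
    are, up to a factor, polynomials in the Ricci operator ([axial_parts]) of
    constant rank ([smooth_row_basis]). In a frame adapted to them B is diagonal,
    which gives the formula for the sectional curvature ([axial_sec]) with the
    functions L and [scal / 2 - 2 * L].

    Conversely the formula for the sectional curvature, with equal constants for a
    real space form, makes B diagonal in an adapted frame, with a double
    eigenvalue on the bivectors containing the axis ([sect_op_of_sec]); and for
    such a B the Deszcz equation holds, L being this eigenvalue
    ([rotate_axial]).

    The functions and distributions on the manifold have to agree in all charts,
    for which the curvature must be shown to be a tensor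
    ([curv_mx_transition]). The connection and the curvature are handled as
    matrices acting on row vectors: Koszul's formula characterises the
    connection, hence its transformation law, and the transformation law of the
    curvature follows by differentiation. The symmetries of the curvature, its
    transformation law and Bianchi's second identity all rest on the symmetry of
    second derivatives ([derive_comm]). *)

Set Implicit Arguments.
Unset Strict Implicit.
Unset Printing Implicit Defensive.

Import Order.TTheory GRing.Theory Num.Theory.
Import numFieldNormedType.Exports.

Local Open Scope classical_set_scope.
Local Open Scope ring_scope.

(** * Calculus of smooth matrix-valued functions *)

Lemma near_eq_differentiable (R : numFieldType) (V W : normedModType R)
  (f g : V -> W) (a : V) :
  (\near a, f a = g a) -> differentiable f a -> differentiable g a.
Proof.
move=> fg df; have fa := nbhs_singleton fg.
have [dfc dfo] := (diff_locallyP _ _).1 df.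
have H : g \o shift a = cst (g a) + 'd f a +o_ 0 id.
  apply/eqaddoP => e e0; move/eqaddoP: dfo => /(_ e e0) H.
  move: fg; rewrite (near_shift 0) subr0 => fg.
  near=> h.
  have gE : (f \o shift a) h = (g \o shift a) h by near: h; exact: fg.
  have : `|(f \o shift a - (cst (f a) + 'd f a)) h| <= e * `|id h|.
    by near: h; exact: H.
  by rewrite [(_ - _) h]/(_ - _) gE fa.
by apply/diff_locallyP; rewrite (diff_unique dfc H).
Unshelve. all: by end_near. Qed.

Section SmoothGeneral.
Context {R : realType} {V W : normedModType R} (U : set V) (oU : open U).
Implicit Types f g : V -> W.

Let near_of f g (fg : forall x, U x -> f x = g x) x :
  U x -> \near x, f x = g x.
Proof. by move=> Ux; near do apply: fg; exact: open_nbhs_nbhs. Unshelve. all: by end_near. Qed.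

Lemma Ck_on_eq k f g : (forall x, U x -> f x = g x) ->
  Ck_on U k f -> Ck_on U k g.
Proof.
elim: k f g => [|k IH] f g fg /=.
  move=> fc x Ux; change (g @ x --> g x); rewrite -(fg x Ux).
  have fcx : f @ x --> f x := fc x Ux.
  by apply: cvg_trans fcx; apply: near_eq_cvg; exact: near_of.
case=> df dDf; split=> [x Ux|v].
  exact: near_eq_differentiable (near_of fg Ux) (df x Ux).
apply: IH (dDf v) => x Ux; exact: near_eq_derive (near_of fg Ux).
Qed.

Lemma smooth_eq f g : (forall x, U x -> f x = g x) ->
  smooth_on U f -> smooth_on U g.
Proof. by move=> fg sf k; apply: Ck_on_eq (sf k). Qed.

Lemma smooth_differentiable f x : smooth_on U f -> U x -> differentiable f x.
Proof. by move=> /(_ 1%N) /= [+ _]; apply. Qed.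

Lemma smooth_derivable f x v : smooth_on U f -> U x -> derivable f x v.
Proof. by move=> sf Ux; apply/diff_derivable/smooth_differentiable. Qed.

Lemma smooth_derive f v : smooth_on U f -> smooth_on U ('D_v f).
Proof. by move=> sf k; have [_] := sf k.+1; apply. Qed.

Lemma smooth_onS (U' : set V) f : U' `<=` U -> smooth_on U f -> smooth_on U' f.
Proof.
move=> sU sf k; move: {sf}(sf k); elim: k f => [|k IH] f /=.
  by move=> + x /sU; apply.
by case=> df dDf; split=> [x /sU/df|v] //; apply: IH.
Qed.

Lemma smooth_cst (w : W) : smooth_on U (cst w).
Proof.
move=> k; elim: k w => [|k IH] w; first by move=> x _; exact: cst_continuous.
split=> [x _|v]; first exact: differentiable_cst.
by rewrite (_ : 'D_v _ = cst 0) //; apply/funext => x; rewrite derive_cst.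
Qed.

Lemma CkD k f g : Ck_on U k f -> Ck_on U k g -> Ck_on U k (fun x => f x + g x).
Proof.
elim: k f g => [|k IH] f g /=.
  by move=> fc gc x Ux; apply: cvgD; [exact: fc|exact: gc].
case=> df dDf [dg dDg]; split=> [x Ux|v].
  by apply: differentiableD; [exact: df|exact: dg].
apply: Ck_on_eq (IH _ _ (dDf v) (dDg v)) => x Ux /=.
by rewrite -deriveD //; apply: diff_derivable; [exact: df|exact: dg].
Qed.

Lemma smoothD f g : smooth_on U f -> smooth_on U g ->
  smooth_on U (fun x => f x + g x).
Proof. by move=> sf sg k; apply: CkD. Qed.

Lemma smooth_sum (I : Type) (r : seq I) (P : pred I) (F : I -> V -> W) :
  (forall i, smooth_on U (F i)) -> smooth_on U (fun x => \sum_(i <- r | P i) F i x).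
Proof.
move=> sF; elim: r => [|i r IH].
  apply: (@smooth_eq (cst 0)); last exact: smooth_cst.
  by move=> x _; rewrite big_nil.
case Pi: (P i).
  apply: (@smooth_eq (fun x => F i x + \sum_(j <- r | P j) F j x)).
    by move=> x _; rewrite big_cons Pi.
  exact: smoothD.
by apply: smooth_eq IH => x _; rewrite big_cons Pi.
Qed.

End SmoothGeneral.

Section SmoothScalar.
Context {R : realType} {V : normedModType R} (U : set V) (oU : open U).
Implicit Types f g : V -> R.

Lemma Ck_on_prev {W : normedModType R} k (f : V -> W) :
  Ck_on U k.+1 f -> Ck_on U k f.
Proof.
elim: k f => [|k IH] f.
  by case=> df _ x Ux; apply: differentiable_continuous; exact: df.
by case=> df dDf; split=> // v; exact: IH.
Qed.

Lemma CkM k f g : Ck_on U k f -> Ck_on U k g -> Ck_on U k (fun x => f x * g x).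
Proof.
elim: k f g => [|k IH] f g /=.
  by move=> fc gc x Ux; apply: cvgM; [exact: fc|exact: gc].
move=> Cf Cg; case: (Cf) => df dDf; case: (Cg) => dg dDg.
split=> [x Ux|v].
  by apply: differentiableM; [exact: df|exact: dg].
have C1 : Ck_on U k (fun x => f x * 'D_v g x) by apply: IH => //; exact: Ck_on_prev.
have C2 : Ck_on U k (fun x => g x * 'D_v f x) by apply: IH => //; exact: Ck_on_prev.
apply: (Ck_on_eq oU _ (CkD oU C1 C2)) => x Ux /=.
by rewrite deriveM //; apply: diff_derivable; [exact: df|exact: dg].
Qed.

Lemma smoothM f g : smooth_on U f -> smooth_on U g ->
  smooth_on U (fun x => f x * g x).
Proof. by move=> sf sg k; apply: CkM. Qed.

Lemma smooth_prod (I : Type) (r : seq I) (P : pred I) (F : I -> V -> R) :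
  (forall i, smooth_on U (F i)) -> smooth_on U (fun x => \prod_(i <- r | P i) F i x).
Proof.
move=> sF; elim: r => [|i r IH].
  apply: (@smooth_eq R V R U oU (cst 1)); last exact: smooth_cst.
  by move=> x _; rewrite big_nil.
case Pi: (P i).
  apply: (@smooth_eq R V R U oU (fun x => F i x * \prod_(j <- r | P j) F j x)).
    by move=> x _; rewrite big_cons Pi.
  exact: smoothM.
by apply: (@smooth_eq R V R U oU _ _ _ IH) => x _; rewrite big_cons Pi.
Qed.

Lemma smoothN f : smooth_on U f -> smooth_on U (fun x => - f x).
Proof.
move=> sf; apply: (@smooth_eq R V R U oU _ _ _ (smoothM (smooth_cst U (-1 : R)) sf)) => x _.
by rewrite mulN1r.
Qed.

Lemma smoothB f g : smooth_on U f -> smooth_on U g ->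
  smooth_on U (fun x => f x - g x).
Proof. by move=> sf sg; apply: smoothD => //; exact: smoothN. Qed.

Lemma smoothV f : (forall x, U x -> f x != 0) -> smooth_on U f ->
  smooth_on U (fun x => (f x)^-1).
Proof.
move=> f0 sf; elim=> [|k IH] /=.
  move=> x Ux; apply: cvgV; first exact: f0.
  by apply: differentiable_continuous; exact: smooth_differentiable sf _.
split=> [x Ux|v].
  by apply: differentiableV (f0 x Ux); exact: smooth_differentiable sf _.
have C1 : Ck_on U k (fun x => - ((f x)^-1 * (f x)^-1) * 'D_v f x).
  apply: CkM; last exact: (smooth_derive v sf).
  apply: (@Ck_on_eq R V _ U oU _ _ _ _ (CkM (smooth_cst U (-1 : R) k) (CkM IH IH))) => x _.
  by rewrite mulN1r.
apply: (@Ck_on_eq R V _ U oU _ _ _ _ C1) => x Ux /=.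
rewrite deriveV; [|exact: f0|exact: smooth_derivable sf _].
by rewrite expr2 invfM.
Qed.

End SmoothScalar.

Section SmoothMatrix.
Context {R : realType} {V : normedModType R} (U : set V) (oU : open U).

Lemma differentiable_mxP m n (F : V -> 'M[R]_(m, n)) x :
  differentiable F x <-> forall i j, differentiable (fun y => F y i j) x.
Proof.
split=> [dF i j|dF].
  exact: (differentiable_comp dF (differentiable_coord _ i j)).
have -> : F = \sum_(i < m) \sum_(j < n) (fun y => F y i j *: delta_mx i j).
  apply/funext => y; rewrite fct_sumE {1}(matrix_sum_delta (F y)).
  by apply: eq_bigr => i _; rewrite fct_sumE.
apply: differentiable_sum => i; apply: differentiable_sum => j.
exact: differentiableZl.
Qed.

Lemma continuous_mxP m n (F : V -> 'M[R]_(m, n)) x :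
  {for x, continuous F} <-> forall i j, {for x, continuous (fun y => F y i j)}.
Proof.
split=> [cF i j|cF].
  apply: (@continuous_comp _ _ _ F (fun N : 'M[R]_(m, n) => N i j)) => //.
  exact: coord_continuous.
apply/cvgrPdist_le => e e0; near=> y.
rewrite /Num.Def.normr/= mx_normrE (bigmax_le _ (ltW e0))//= => i _.
rewrite !mxE; move: i; near: y; apply: filter_forall => /= i.
by move: (cF i.1 i.2) => /cvgrPdist_le; apply.
Unshelve. all: by end_near. Qed.

Lemma derive_coord m n (F : V -> 'M[R]_(m, n)) x v i j :
  derivable F x v -> 'D_v F x i j = 'D_v (fun y => F y i j) x.
Proof. by move=> dF; rewrite derive_mx // mxE. Qed.

Lemma smooth_mxP m n (F : V -> 'M[R]_(m, n)) :
  smooth_on U F <-> forall i j, smooth_on U (fun x => F x i j).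
Proof.
split=> [sF i j k|sF k].
  move: {sF}(sF k); elim: k F => [|k IH] F /=.
    by move=> cF x Ux; apply/(continuous_mxP _ _).1; exact: cF.
  case=> dF dDF; split=> [x Ux|v]; first by apply/(differentiable_mxP _ _).1; exact: dF.
  apply: (@Ck_on_eq R V _ U oU _ _ _ _ (IH _ (dDF v))) => x Ux.
  by rewrite derive_coord //; apply: diff_derivable; exact: dF.
have {}sF : forall i j, Ck_on U k (fun x => F x i j) by move=> i j; exact: sF.
elim: k F sF => [|k IH] F sF /=.
  by move=> x Ux; apply/continuous_mxP => i j; exact: (sF i j).
have dF x : U x -> differentiable F x.
  by move=> Ux; apply/differentiable_mxP => i j; apply: (sF i j).1.
split=> // v; apply: IH => i j.
apply: (@Ck_on_eq R V _ U oU _ _ _ _ ((sF i j).2 v)) => x Ux.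
by rewrite derive_coord //; apply: diff_derivable; exact: dF.
Qed.

Lemma smooth_mulmx m n p (F : V -> 'M[R]_(m, n)) (G : V -> 'M[R]_(n, p)) :
  smooth_on U F -> smooth_on U G -> smooth_on U (fun x => F x *m G x).
Proof.
move=> /smooth_mxP sF /smooth_mxP sG; apply/smooth_mxP => i j.
apply: (@smooth_eq R V R U oU (fun x => \sum_k F x i k * G x k j)).
  by move=> x _; rewrite mxE.
by apply: smooth_sum => // k; exact: smoothM.
Qed.

Lemma smooth_trmx m n (F : V -> 'M[R]_(m, n)) :
  smooth_on U F -> smooth_on U (fun x => (F x)^T).
Proof.
move=> /smooth_mxP sF; apply/smooth_mxP => i j.
by apply: (@smooth_eq R V R U oU _ _ _ (sF j i)) => x _; rewrite mxE.
Qed.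

Lemma smooth_mxN m n (F : V -> 'M[R]_(m, n)) :
  smooth_on U F -> smooth_on U (fun x => - F x).
Proof.
move=> /smooth_mxP sF; apply/smooth_mxP => i j.
by apply: (@smooth_eq R V R U oU _ _ _ (smoothN oU (sF i j))) => x _; rewrite mxE.
Qed.

Lemma smooth_mxB m n (F G : V -> 'M[R]_(m, n)) :
  smooth_on U F -> smooth_on U G -> smooth_on U (fun x => F x - G x).
Proof. by move=> sF sG; apply: smoothD => //; exact: smooth_mxN. Qed.

Lemma smooth_mxZ m n (f : V -> R) (F : V -> 'M[R]_(m, n)) :
  smooth_on U f -> smooth_on U F -> smooth_on U (fun x => f x *: F x).
Proof.
move=> sf /smooth_mxP sF; apply/smooth_mxP => i j.
by apply: (@smooth_eq R V R U oU _ _ _ (smoothM oU sf (sF i j))) => x _; rewrite mxE.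
Qed.

Lemma smooth_scalar_mx n (f : V -> R) :
  smooth_on U f -> smooth_on U (fun x => (f x)%:M : 'M[R]_n).
Proof.
move=> sf; apply: (@smooth_eq R V _ U oU _ _ _ (smooth_mxZ sf (smooth_cst U 1%:M))) => x _.
by rewrite scalemx1.
Qed.

Lemma smooth_mxtrace n (F : V -> 'M[R]_n) :
  smooth_on U F -> smooth_on U (fun x => \tr (F x)).
Proof. by move=> /smooth_mxP sF; apply: smooth_sum => // i. Qed.

Lemma smooth_det n (F : V -> 'M[R]_n) :
  smooth_on U F -> smooth_on U (fun x => \det (F x)).
Proof.
move=> /smooth_mxP sF; apply: smooth_sum => // s; apply: smoothM => //.
  exact: smooth_cst.
exact: smooth_prod.
Qed.

Lemma smooth_invmx n (F : V -> 'M[R]_n) :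
  (forall x, U x -> F x \in unitmx) ->
  smooth_on U F -> smooth_on U (fun x => invmx (F x)).
Proof.
move=> uF sF.
apply: (@smooth_eq R V _ U oU (fun x => (\det (F x))^-1 *: \adj (F x))).
  by move=> x Ux; rewrite /invmx uF.
apply: smooth_mxZ.
  apply: smoothV => //; last exact: smooth_det.
  by move=> x Ux; rewrite -unitfE -unitmxE uF.
apply/smooth_mxP => i j.
apply: (@smooth_eq R V R U oU (fun x => (-1) ^+ (j + i) * \det (row' j (col' i (F x))))).
  by move=> x _; rewrite mxE.
apply: smoothM => //; first exact: smooth_cst.
apply: smooth_det; apply/smooth_mxP => a b.
apply: (@smooth_eq R V R U oU _ _ _ ((smooth_mxP _).1 sF (lift j a) (lift i b))) => x _.
by rewrite !mxE.
Qed.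

End SmoothMatrix.

Lemma derive_comp (R : realType) (V W Z : normedModType R) (f : V -> W) (F : W -> Z) x u :
  differentiable f x -> differentiable F (f x) ->
  'D_u (F \o f) x = 'D_('D_u f x) F (f x).
Proof.
move=> df dF; rewrite !deriveE //; last exact: differentiable_comp.
by rewrite diff_comp.
Qed.

Section DeriveMatrix.
Context {R : realType} {V : normedModType R}.

Lemma derive_mulmx m n p (F : V -> 'M[R]_(m, n)) (G : V -> 'M[R]_(n, p)) x v :
  derivable F x v -> derivable G x v ->
  'D_v (fun y => F y *m G y) x = 'D_v F x *m G x + F x *m 'D_v G x.
Proof.
move=> dF dG.
have dF' i j : derivable (fun y => F y i j) x v by apply/(derivable_mxP _ _ _).1.
have dG' i j : derivable (fun y => G y i j) x v by apply/(derivable_mxP _ _ _).1.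
have E i j : (fun y => (F y *m G y) i j)
   = \sum_k ((fun y => F y i k) * (fun y => G y k j)).
  by apply/funext => y; rewrite mxE fct_sumE.
have dE i j : derivable (fun y => (F y *m G y) i j) x v.
  by rewrite E; apply: derivable_sum => k; exact: derivableM.
apply/matrixP => i j; rewrite derive_coord; last exact/derivable_mxP.
rewrite E derive_sum; last by move=> k; exact: derivableM.
rewrite !mxE -big_split; apply: eq_bigr => k _ /=.
rewrite deriveM // !derive_coord // /GRing.scale /= addrC; congr (_ + _).
by rewrite mulrC.
Qed.

Lemma derive_trmx m n (F : V -> 'M[R]_(m, n)) x v :
  derivable F x v -> 'D_v (fun y => (F y)^T) x = ('D_v F x)^T.
Proof.
move=> dF; have dF' := (derivable_mxP _ _ _).1 dF.
have E i j : (fun y => (F y)^T i j) = (fun y => F y j i).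
  by apply/funext => y; rewrite mxE.
apply/matrixP => i j; rewrite mxE derive_coord; last first.
  by apply/derivable_mxP => a b; rewrite E.
by rewrite E derive_coord.
Qed.

Lemma derivable_mulmx m n p (F : V -> 'M[R]_(m, n)) (G : V -> 'M[R]_(n, p)) x v :
  derivable F x v -> derivable G x v -> derivable (fun y => F y *m G y) x v.
Proof.
move=> dF dG; apply/derivable_mxP => i j.
rewrite (_ : (fun y => _) = \sum_k ((fun y => F y i k) * (fun y => G y k j))).
  apply: derivable_sum => k; apply: derivableM.
    exact: (derivable_mxP _ _ _).1 dF i k.
  exact: (derivable_mxP _ _ _).1 dG k j.
by apply/funext => y; rewrite mxE fct_sumE.
Qed.

Lemma derive_mulmxl m n p (B : 'M[R]_(m, n)) (F : V -> 'M[R]_(n, p)) x v :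
  derivable F x v -> 'D_v (fun y => B *m F y) x = B *m 'D_v F x.
Proof.
move=> dF; have := derive_mulmx (derivable_cst B x v) dF.
by rewrite derive_cst mul0mx add0r.
Qed.

Lemma derive_scalemx m n (k : V -> R) (F : V -> 'M[R]_(m, n)) x v :
  derivable k x v -> derivable F x v ->
  'D_v (fun y => k y *: F y) x = 'D_v k x *: F x + k x *: 'D_v F x.
Proof.
move=> dk dF; have dFij i j := (derivable_mxP _ _ _).1 dF i j.
have E i j : (fun y => (k y *: F y) i j) = k * (fun y => F y i j).
  by apply/funext => y; rewrite mxE.
have dP : derivable (fun y => k y *: F y) x v.
  by apply/derivable_mxP => i j; rewrite E; exact: derivableM.
apply/matrixP => i j; rewrite derive_coord // E deriveM // !mxE derive_coord //.
by rewrite /GRing.scale /= addrC (mulrC (F x i j)).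
Qed.

End DeriveMatrix.

(** * Symmetry of second derivatives *)

Section Clairaut.
Context {R : realType} {V : normedModType R}.

Lemma is_derive_line (f : V -> R) x w t :
  derivable f (x + t *: w) w ->
  is_derive t 1 (fun s : R => f (x + s *: w)) ('D_w f (x + t *: w)).
Proof.
have E : (fun h : R => h^-1 *: (f (x + (h *: (1 : R) + t) *: w) - f (x + t *: w)))
   = (fun h => h^-1 *: (f (h *: w + (x + t *: w)) - f (x + t *: w))).
  apply/funext => h; congr (_ *: (f _ - _)).
  by rewrite [h *: (1 : R)]mulr1 scalerDl addrCA.
by move=> df; apply: DeriveDef; rewrite /derivable /derive E.
Qed.

Lemma mean_value_line (f : V -> R) x w s : 0 <= s ->
  (forall t, 0 <= t <= s -> derivable f (x + t *: w) w) ->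
  exists2 t, 0 <= t <= s & f (x + s *: w) - f x = s * 'D_w f (x + t *: w).
Proof.
move=> s0 df.
have [||t ts E] := @MVT_segment R (fun t => f (x + t *: w))
    (fun t => 'D_w f (x + t *: w)) 0 s s0.
- by move=> t /itvP ts; apply/is_derive_line/df; rewrite !ts.
- apply: derivable_within_continuous => t /itvP ts.
  by have [] := is_derive_line (df t _); rewrite // !ts.
exists t; first by rewrite in_itv in ts.
by rewrite scale0r addr0 subr0 mulrC in E.
Qed.

(** The mean value theorem is applied along [v] to [fun y => f (y + s *: u) - f y],
    then along [u] to ['D_v f]. *)
Lemma second_difference (f : V -> R) (U : set V) x u v (s : R) :
  open U -> smooth_on U f -> 0 <= s ->
  (forall a b : R, 0 <= a <= s -> 0 <= b <= s -> U (x + a *: u + b *: v)) ->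
  exists a b : R, [/\ 0 <= a <= s, 0 <= b <= s &
    f (x + s *: u + s *: v) - f (x + s *: u) - f (x + s *: v) + f x =
    s * s * 'D_u ('D_v f) (x + a *: u + b *: v)].
Proof.
move=> oU sf s0 HU.
have aux (p q r w : R) : p - q - r + w = (p - r) - (q - w) by ring.
pose g y := f (y + s *: u) - f y.
have dsh y : derivable f (y + s *: u) v ->
    is_derive y v (fun z => f (z + s *: u)) ('D_v f (y + s *: u)).
  have E : (fun h : R => h^-1 *: (f (h *: v + y + s *: u) - f (y + s *: u)))
     = (fun h => h^-1 *: (f (h *: v + (y + s *: u)) - f (y + s *: u))).
    by apply/funext => h; rewrite addrA.
  by move=> df; apply: DeriveDef; rewrite /derivable /derive E.
have ss : 0 <= s <= s by rewrite s0 lexx.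
have zs : 0 <= (0 : R) <= s by rewrite s0 lexx.
have dg (b : R) : 0 <= b <= s -> is_derive (x + b *: v) v g
    ('D_v f (x + s *: u + b *: v) - 'D_v f (x + b *: v)).
  move=> bs; have dU y : U y -> derivable f y v by exact: smooth_derivable sf.
  have d1 : derivable f (x + b *: v + s *: u) v.
    by rewrite addrAC; apply: dU; exact: HU.
  have d2 : derivable f (x + b *: v) v.
    by apply: dU; rewrite -[x]addr0 -(scale0r u); exact: HU.
  have := dsh _ d1 => H1; have H2 := derivableP d2.
  have -> : g = (fun z => f (z + s *: u)) - f by [].
  by rewrite [x + s *: u + b *: v]addrAC; exact: is_deriveB.
have [b bs Eb] := @mean_value_line g x v s s0 (fun b bs => @ex_derive _ _ _ _ _ _ _ (dg b bs)).
have dDf (a : R) : 0 <= a <= s -> derivable ('D_v f) (x + b *: v + a *: u) u.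
  move=> as_; apply: (smooth_derivable (smooth_derive v sf)).
  by rewrite addrAC; exact: HU.
have [a as_ Ea] := mean_value_line s0 dDf.
exists a, b; split; [exact: as_|exact: bs|].
move: Eb; rewrite (@derive_val _ _ _ _ _ _ _ (dg b bs)) /g.
rewrite [x + s *: u + _]addrAC Ea => Eb.
rewrite [x + a *: u + _]addrAC -mulrA -Eb [x + s *: v + _]addrAC.
exact: aux.
Qed.

(** For the two mixed second derivatives of a function: a common second
    difference is a value of each of them, at points arbitrarily near [x]. *)
Lemma eq_continuous_meeting (h1 h2 : V -> R) (x : V) (U : set V) :
  nbhs x U -> {for x, continuous h1} -> {for x, continuous h2} ->
  (forall d, 0 < d -> ball x d `<=` U ->
     exists y1 y2, [/\ ball x d y1, ball x d y2 & h1 y1 = h2 y2]) ->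
  h1 x = h2 x.
Proof.
move=> nU c1 c2 meet.
apply/eqP; rewrite -subr_eq0 -normr_le0; apply/ler_addgt0Pl => e e0; rewrite addr0.
have e2 : 0 < e / 2 by rewrite divr_gt0.
move/cvgrPdist_le: c1 => /(_ _ e2) c1; move/cvgrPdist_le: c2 => /(_ _ e2) c2.
have : \forall y \near x, [/\ U y, `|h1 x - h1 y| <= e / 2 & `|h2 x - h2 y| <= e / 2].
  by apply: filterS3 nU c1 c2 => y; split.
move=> /nbhs_ballP [d /= d0 Hd].
have BU : ball x d `<=` U by move=> y /Hd [].
have [y1 [y2 [B1 B2 E]]] := meet d d0 BU.
have [_ H1 _] := Hd _ B1; have [_ _ H2] := Hd _ B2.
have -> : h1 x - h2 x = (h1 x - h1 y1) - (h2 x - h2 y2) by rewrite E; ring.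
rewrite [e]splitr; apply: le_trans (ler_normB _ _) _; exact: lerD.
Qed.

(** Schwarz's theorem. Exchanging [u] and [v] does not change the second
    difference of [f], which is [s * s] times a value of either mixed
    derivative. *)
Lemma derive_comm (f : V -> R) (U : set V) x u v :
  open U -> smooth_on U f -> U x -> 'D_u ('D_v f) x = 'D_v ('D_u f) x.
Proof.
move=> oU sf Ux.
apply: (@eq_continuous_meeting ('D_u ('D_v f)) ('D_v ('D_u f)) x U).
- exact: open_nbhs_nbhs.
- exact: (smooth_derive u (smooth_derive v sf) 0%N x Ux).
- exact: (smooth_derive v (smooth_derive u sf) 0%N x Ux).
move=> d d0 BU.
(* a step small enough for the parallelogram to stay in the ball *)
pose s := d / (`|u| + `|v| + 1) / 2.
have N0 : 0 < `|u| + `|v| + 1 by rewrite ltr_wpDl // addr_ge0.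
have s0 : 0 < s by rewrite !divr_gt0.
have in_ball (a b : R) : 0 <= a <= s -> 0 <= b <= s -> ball x d (x + a *: u + b *: v).
  move=> /andP[a0 as_] /andP[b0 bs]; rewrite -ball_normE /=.
  rewrite -addrA opprD addNKr normrN.
  apply: le_lt_trans (ler_normD _ _) _; rewrite !normrZ !ger0_norm //.
  apply: (@le_lt_trans _ _ (s * (`|u| + `|v|))).
    by rewrite mulrDr lerD // ler_wpM2r.
  apply: (@lt_trans _ _ (s * (`|u| + `|v| + 1))); first by rewrite ltr_pM2l // ltrDl.
  by rewrite /s mulrAC divfK ?gt_eqF // ltr_pdivrMr // mulr_natr mulr2n ltrDl.
have in_ball' (a b : R) : 0 <= a <= s -> 0 <= b <= s -> ball x d (x + a *: v + b *: u).
  by move=> ha hb; rewrite addrAC; exact: in_ball.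
have [a [b [as_ bs E1]]] := second_difference oU sf (ltW s0)
   (fun a b ha hb => BU _ (in_ball a b ha hb)).
have [b' [a' [bs' as' E2]]] := second_difference oU sf (ltW s0)
   (fun a b ha hb => BU _ (in_ball' a b ha hb)).
exists (x + a *: u + b *: v), (x + b' *: v + a' *: u).
split; [exact: in_ball|exact: in_ball'|].
have ss0 : s * s != 0 by rewrite mulf_neq0 ?gt_eqF.
rewrite [x + s *: v + s *: u]addrAC (addrAC (f _)) E1 in E2.
exact: mulfI ss0 _ _ E2.
Qed.

Lemma derive_comm_mx m n (F : V -> 'M[R]_(m, n)) (U : set V) x u v :
  open U -> smooth_on U F -> U x -> 'D_u ('D_v F) x = 'D_v ('D_u F) x.
Proof.
move=> oU sF Ux; have sFij := (smooth_mxP oU F).1 sF.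
have D1 w i j y : U y -> 'D_w F y i j = 'D_w (fun z => F z i j) y.
  by move=> Uy; apply/derive_coord/(smooth_derivable sF Uy).
have D2 w w' i j : 'D_w ('D_w' F) x i j = 'D_w ('D_w' (fun z => F z i j)) x.
  rewrite derive_coord; last exact: (smooth_derivable (smooth_derive w' sF) Ux).
  apply: near_eq_derive; near=> y; apply: D1.
  by near: y; exact: open_nbhs_nbhs.
apply/matrixP => i j; apply: etrans (D2 u v i j) _.
apply: etrans (derive_comm u v oU (sFij i j) Ux) _.
exact: esym (D2 v u i j).
Unshelve. all: by end_near. Qed.

Lemma locally_constant_of_derive0 (f : V -> R) x d :
  (forall y, ball x d y -> differentiable f y) ->
  (forall y v, ball x d y -> 'D_v f y = 0) ->
  forall y, ball x d y -> f y = f x.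
Proof.
move=> df Df0 y; rewrite -ball_normE /= => By.
have Bt (t : R) : 0 <= t <= 1 -> ball x d (x + t *: (y - x)).
  move=> /andP[t0 t1]; rewrite -ball_normE /= opprD addNKr normrN normrZ ger0_norm //.
  by rewrite distrC in By; apply: le_lt_trans By; rewrite ler_piMl.
have dl (t : R) : 0 <= t <= 1 -> derivable f (x + t *: (y - x)) (y - x).
  by move=> ht; apply/diff_derivable/df/Bt.
have [t ts E] := mean_value_line ler01 dl.
rewrite (Df0 _ _ (Bt t ts)) mulr0 scale1r [x + _]addrC subrK in E.
by apply/eqP; rewrite -subr_eq0 E.
Qed.

End Clairaut.

(** * The Levi-Civita connection of a chart *)

Section Bilin.
Context {R : realType} {n : nat}.
Implicit Types (A B G P : 'M[R]_n) (u v w : 'rV[R]_n).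

Lemma bilinE A u v : bilin A u v = \sum_i \sum_j u 0 i * A i j * v 0 j.
Proof.
rewrite /bilin mxE exchange_big; apply: eq_bigr => j _ /=.
by rewrite !mxE mulr_suml.
Qed.

Lemma bilin_delta A i j : bilin A (delta_mx 0 i) (delta_mx 0 j) = A i j.
Proof. by rewrite /bilin -rowE trmx_delta -colE !mxE. Qed.

Lemma bilin_inj A B : (forall u v, bilin A u v = bilin B u v) -> A = B.
Proof. by move=> AB; apply/matrixP => i j; rewrite -!bilin_delta. Qed.

Lemma bilin_tr A u v : bilin A^T u v = bilin A v u.
Proof. by rewrite /bilin -[in RHS](trmxK (v *m A *m u^T)) [in RHS]mxE !trmx_mul trmxK mulmxA. Qed.

Lemma bilin_mul A (P Q : 'M[R]_n) u v :
  bilin (P *m A *m Q^T) u v = bilin A (u *m P) (v *m Q).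
Proof. by rewrite /bilin trmx_mul !mulmxA. Qed.

Lemma bilin_row m (F : 'M[R]_(m, n)) A i j :
  (F *m A *m F^T) i j = bilin A (row i F) (row j F).
Proof.
rewrite /bilin tr_row -row_mul !mxE; apply: eq_bigr => k _.
by rewrite [(row i _) 0 k]mxE [(col j _) k 0]mxE.
Qed.

Lemma bilin_mull A P u v : bilin (P *m A) u v = bilin A (u *m P) v.
Proof. by rewrite /bilin !mulmxA. Qed.

Lemma bilinDm A B u v : bilin (A + B) u v = bilin A u v + bilin B u v.
Proof. by rewrite /bilin mulmxDr mulmxDl mxE. Qed.

Lemma bilinNm A u v : bilin (- A) u v = - bilin A u v.
Proof. by rewrite /bilin mulmxN mulNmx mxE. Qed.

Lemma bilinZm a A u v : bilin (a *: A) u v = a * bilin A u v.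
Proof. by rewrite /bilin -scalemxAr -scalemxAl mxE. Qed.

Lemma bilinDl A u v w : bilin A (u + v) w = bilin A u w + bilin A v w.
Proof. by rewrite /bilin !mulmxDl mxE. Qed.

Lemma bilinZl A a u w : bilin A (a *: u) w = a * bilin A u w.
Proof. by rewrite /bilin -!scalemxAl mxE. Qed.

Lemma bilinDr A u v w : bilin A w (u + v) = bilin A w u + bilin A w v.
Proof. by rewrite -(trmxK A) !(bilin_tr A^T) bilinDl. Qed.

Lemma bilinZr A a u w : bilin A w (a *: u) = a * bilin A w u.
Proof. by rewrite -(trmxK A) !(bilin_tr A^T) bilinZl. Qed.

Lemma posdef_unitmx G : (forall v, v != 0 -> 0 < bilin G v v) -> G \in unitmx.
Proof.
move=> Gpos; rewrite unitmxE unitfE; apply/det0P => -[v v0 vG].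
by have := Gpos v v0; rewrite /bilin vG mul0mx mxE ltxx.
Qed.

End Bilin.

Lemma derive_lincomb (R : realType) (n : nat) (W : normedModType R)
    (F : 'rV[R]_n -> W) x u :
  differentiable F x ->
  'D_u F x = \sum_i u 0 i *: 'D_(delta_mx 0 i) F x.
Proof.
move=> dF; rewrite deriveE // {1}[u]row_sum_delta linear_sum /=.
by apply: eq_bigr => i _; rewrite linearZ /= -deriveE.
Qed.

Section LinearCombinationEntries.
Context {R : pzRingType} {m n : nat}.
Implicit Types A B : 'M[R]_(m, n).

Lemma mx_addE A B i j : (A + B) i j = A i j + B i j.
Proof. by rewrite mxE. Qed.

Lemma mx_oppE A i j : (- A) i j = - A i j.
Proof. by rewrite mxE. Qed.

Lemma mx_scaleE a A i j : (a *: A) i j = a * A i j.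
Proof. by rewrite mxE. Qed.

Lemma mx_zeroE i j : (0 : 'M[R]_(m, n)) i j = 0.
Proof. by rewrite mxE. Qed.

(** Entries of a linear combination, leaving those of products alone: the
    resulting scalar identities can be left to [ring], with the entries of the
    noncommutative products as atoms. *)
Definition mx_lincombE := (mx_addE, mx_oppE, mx_scaleE, mx_zeroE).

End LinearCombinationEntries.

Lemma sum_of_halves (R : realFieldType) (p q r a b : R) :
  2 * a = p + q - r -> 2 * b = p + r - q -> p = a + b.
Proof. by move=> Ea Eb; lra. Qed.

Lemma swap_sum (R : zmodType) (p q r s : R) : r = s -> p + q - r = q + p - s.
Proof. by move=> ->; rewrite [p + q]addrC. Qed.

Lemma curv_expr_linear (R : comPzRingType) (n : nat) (a : R)
    (P1 P2 Q1 Q2 X Y Z : 'M[R]_n) :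
  (a *: P1 + P2) - (a *: Q1 + Q2) + Z *m (a *: X + Y) - (a *: X + Y) *m Z =
  a *: (P1 - Q1 + Z *m X - X *m Z) + (P2 - Q2 + Z *m Y - Y *m Z).
Proof.
rewrite !mulmxDl !mulmxDr -!scalemxAl -!scalemxAr.
by apply/matrixP => i j; rewrite !mx_lincombE; ring.
Qed.

Lemma curv_expr_bianchi (R : comPzRingType) (n : nat) (u v w : 'rV[R]_n)
    (Cu Cv Cw uv vu uw wu vw wv : 'M[R]_n) :
  v *m Cu = u *m Cv -> w *m Cu = u *m Cw -> w *m Cv = v *m Cw ->
  w *m uv = v *m uw -> w *m vu = u *m vw -> v *m wu = u *m wv ->
  w *m (uv - vu + Cv *m Cu - Cu *m Cv) + u *m (vw - wv + Cw *m Cv - Cv *m Cw)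
  + v *m (wu - uw + Cu *m Cw - Cw *m Cu) = 0.
Proof.
move=> Euv Euw Evw D1 D2 D3.
rewrite !mulmxBr !mulmxDr !mulmxN !mulmxA D1 D2 D3 Euv Euw Evw.
by apply/rowP => i; rewrite !mx_lincombE; ring.
Qed.

(** The symmetry [D_X (D_Y G) = D_Y (D_X G)] of second derivatives, once both
    sides are expanded by metric compatibility, is the skew-symmetry of the
    curvature with respect to [G]. *)
Lemma curv_expr_skew (R : comPzRingType) (n : nat) (G Cu Cv uv vu : 'M[R]_n) :
  G^T = G ->
  uv *m G + Cv *m (Cu *m G + G *m Cu^T) + (uv *m G + Cv *m (Cu *m G + G *m Cu^T))^T =
  vu *m G + Cu *m (Cv *m G + G *m Cv^T) + (vu *m G + Cu *m (Cv *m G + G *m Cv^T))^T ->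
  (uv - vu + Cv *m Cu - Cu *m Cv) *m G + G *m (uv - vu + Cv *m Cu - Cu *m Cv)^T = 0.
Proof.
have trD (B C : 'M[R]_n) : (B + C)^T = B^T + C^T by exact: linearD.
have trN (B : 'M[R]_n) : (- B)^T = - B^T by exact: linearN.
move=> sG; rewrite !(trD, trN, trmx_mul, trmxK) sG !(mulmxDl, mulmxDr, mulNmx, mulmxN) !mulmxA => E.
apply/matrixP => i j; move/matrixP: E => /(_ i j).
rewrite !mx_lincombE => E.
apply/eqP; rewrite -subr_eq0.
move/eqP: E; rewrite -subr_eq0; congr (_ == _); ring.
Qed.

Section LeviCivita.
Context {R : realType} {n : nat} {M : topologicalType}
  {A : smooth_manifold R n M} (g : riemannian_metric A) (c : chart A).
Local Notation U := (image_of c).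
Local Notation G := (gram g c).
Implicit Types (u v w X Y Z : 'rV[R]_n).

Let oU : open U. Proof. exact: chart_map_open. Qed.

Lemma gram_unit x : U x -> G x \in unitmx.
Proof. by move=> Ux; apply: posdef_unitmx; exact: gram_pos. Qed.

(** Operators act on row vectors from the right: [v *m conn u x] is the
    Christoffel term of the covariant derivative of a field with value [v] in
    the direction [u], so that this derivative is ['D_u + (_ *m conn u)]. *)
Definition conn u x : 'M[R]_n :=
  \matrix_(j, k) \sum_i u 0 i * christoffel g c k i j x.

Lemma partial_gramE i j l x : U x ->
  partial_gram g c i j l x = 'D_(delta_mx 0 i) G x j l.
Proof.
move=> Ux; rewrite derive_coord //; apply: smooth_derivable Ux.
exact: gram_smooth.
Qed.

Lemma derive_gram_sym u x : U x -> ('D_u G x)^T = 'D_u G x.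
Proof.
move=> Ux; rewrite -derive_trmx; last by apply: smooth_derivable Ux; exact: gram_smooth.
by apply: near_eq_derive; near=> y; apply: gram_sym; near: y; exact: open_nbhs_nbhs.
Unshelve. all: by end_near. Qed.

Lemma conn_lower i j l x : U x ->
  (conn (delta_mx 0 i) x *m G x) j l =
  2^-1 * ('D_(delta_mx 0 i) G x j l + 'D_(delta_mx 0 j) G x i l
          - 'D_(delta_mx 0 l) G x i j).
Proof.
move=> Ux; rewrite mxE.
pose S m : R := 'D_(delta_mx 0 i) G x j m + 'D_(delta_mx 0 j) G x i m
          - 'D_(delta_mx 0 m) G x i j.
have E k : conn (delta_mx 0 i) x j k = 2^-1 * \sum_m invmx (G x) k m * S m.
  rewrite mxE (bigD1 i) //= big1 ?addr0; last first.
    by move=> i' ii'; rewrite mxE (negPf ii') mul0r.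
  rewrite mxE !eqxx mul1r /christoffel; congr (_ * _); apply: eq_bigr => m _.
  by rewrite !partial_gramE.
under eq_bigr do rewrite E -mulrA mulr_suml.
rewrite -mulr_sumr exchange_big /=; congr (_ * _).
rewrite -[RHS]/(S l); have -> : S l = \sum_m (1%:M : 'M[R]_n) m l * S m.
  rewrite (bigD1 l) //= big1 ?addr0; first by rewrite mxE eqxx mul1r.
  by move=> m ml; rewrite mxE (negPf ml) mul0r.
apply: eq_bigr => m _; rewrite -(mulVmx (gram_unit Ux)) mxE mulr_suml.
apply: eq_bigr => k _; rewrite mulrAC; congr (_ * _ * _).
by rewrite -[in LHS](gram_sym g Ux) -trmx_inv mxE.
Qed.

Lemma connE u x : conn u x = \sum_i u 0 i *: conn (delta_mx 0 i) x.
Proof.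
apply/matrixP => j k; rewrite summxE mxE; apply: eq_bigr => i _; rewrite !mxE.
congr (_ * _); rewrite (bigD1 i) //= big1 ?addr0 ?mxE ?eqxx ?mul1r //.
by move=> i' ii'; rewrite mxE (negPf ii') andbF mul0r.
Qed.

(** Koszul's formula determines the connection; freeness of torsion,
    compatibility with the metric and the transformation law are all read off
    it, without further use of the Christoffel symbols. *)
Lemma koszul u v w x : U x ->
  2 * bilin (conn u x *m G x) v w =
  bilin ('D_u G x) v w + bilin ('D_v G x) u w - bilin ('D_w G x) u v.
Proof.
move=> Ux; have dG : differentiable G x.
  by apply: smooth_differentiable Ux; exact: gram_smooth.
rewrite !(derive_lincomb _ dG) (connE u) mulmx_suml.
have bsum (a : 'rV[R]_n) (F : 'I_n -> 'M[R]_n) (p q : 'rV[R]_n) :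
   bilin (\sum_i a 0 i *: F i) p q = \sum_i a 0 i * bilin (F i) p q.
  rewrite /bilin mulmx_sumr mulmx_suml summxE; apply: eq_bigr => i _.
  by rewrite -scalemxAr -scalemxAl mxE.
under eq_bigr do rewrite -scalemxAl.
rewrite !bsum.
have -> : \sum_i v 0 i * bilin ('D_(delta_mx 0 i) G x) u w =
   \sum_i \sum_j \sum_l u 0 i * v 0 j * w 0 l * 'D_(delta_mx 0 j) G x i l.
  rewrite exchange_big; apply: eq_bigr => j _ /=.
  rewrite bilinE mulr_sumr; apply: eq_bigr => i _; rewrite mulr_sumr.
  by apply: eq_bigr => l _; ring.
have -> : \sum_i w 0 i * bilin ('D_(delta_mx 0 i) G x) u v =
   \sum_i \sum_j \sum_l u 0 i * v 0 j * w 0 l * 'D_(delta_mx 0 l) G x i j.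
  transitivity (\sum_l \sum_i \sum_j u 0 i * v 0 j * w 0 l * 'D_(delta_mx 0 l) G x i j).
    apply: eq_bigr => l _; rewrite bilinE mulr_sumr; apply: eq_bigr => i _.
    by rewrite mulr_sumr; apply: eq_bigr => j _; ring.
  rewrite exchange_big; apply: eq_bigr => i _ /=.
  by rewrite exchange_big.
rewrite -sumrN mulr_sumr -!big_split /=; apply: eq_bigr => i _.
rewrite !bilinE !mulr_sumr -sumrN -!big_split /=; apply: eq_bigr => j _.
rewrite !mulr_sumr -sumrN -!big_split /=; apply: eq_bigr => l _.
by rewrite conn_lower //; field.
Qed.

Lemma conn_linear a u v x : conn (a *: u + v) x = a *: conn u x + conn v x.
Proof.
rewrite (connE (a *: u + v)) (connE u) (connE v) scaler_sumr -big_split.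
by apply: eq_bigr => i _ /=; rewrite !mxE scalerDl scalerA.
Qed.

Lemma bilin_gram_inj x u v : U x ->
  (forall w, bilin (G x) u w = bilin (G x) v w) -> u = v.
Proof.
move=> Ux uv; suff : u *m G x = v *m G x.
  by move/(congr1 (mulmx^~ (invmx (G x)))); rewrite !mulmxK ?gram_unit.
apply/rowP => j; have := uv (delta_mx 0 j).
by rewrite /bilin trmx_delta -!colE !mxE.
Qed.

Lemma conn_torsion u v x : U x -> v *m conn u x = u *m conn v x.
Proof.
move=> Ux; apply: (bilin_gram_inj Ux) => w; rewrite -!bilin_mull.
have n2 : (2 : R) != 0 by rewrite pnatr_eq0.
apply: (mulfI n2); apply: etrans (koszul u v w Ux) _.
apply: etrans _ (esym (koszul v u w Ux)).
have E : bilin ('D_w G x) u v = bilin ('D_w G x) v u.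
  by rewrite -[in LHS](derive_gram_sym w Ux) bilin_tr.
exact: swap_sum E.
Qed.

(** The sum of Koszul's formulas for [(u, v, w)] and [(u, w, v)]. *)
Lemma conn_metric u x : U x ->
  'D_u G x = conn u x *m G x + G x *m (conn u x)^T.
Proof.
move=> Ux; apply: bilin_inj => v w; rewrite bilinDm.
have -> : bilin (G x *m (conn u x)^T) v w = bilin (conn u x *m G x) w v.
  by rewrite -[LHS]bilin_tr trmx_mul trmxK gram_sym.
have E1 := koszul u v w Ux; have := koszul u w v Ux.
rewrite -(derive_gram_sym u Ux) bilin_tr (derive_gram_sym u Ux) => E2.
exact: sum_of_halves E1 E2.
Qed.

Lemma smooth_christoffel k i j : smooth_on U (christoffel g c k i j).
Proof.
have sG := (smooth_mxP oU _).1 (gram_smooth g c).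
have sI : smooth_on U (fun x => invmx (G x)).
  apply: smooth_invmx => //; first exact: gram_unit.
  exact: gram_smooth.
have sI' := (smooth_mxP oU _).1 sI.
have sp a b d : smooth_on U (partial_gram g c a b d) by exact: smooth_derive.
apply: smoothM => //; first exact: smooth_cst.
apply: smooth_sum => // l; apply: smoothM => //.
by apply: smoothB => //; exact: smoothD.
Qed.

Lemma smooth_conn u : smooth_on U (conn u).
Proof.
apply/(smooth_mxP oU) => j k.
apply: (@smooth_eq R _ _ U oU (fun x => \sum_i u 0 i * christoffel g c k i j x)).
  by move=> x _; rewrite mxE.
apply: smooth_sum => // i; apply: smoothM => //; first exact: smooth_cst.
exact: smooth_christoffel.
Qed.

(** The commutator of the covariant derivatives in the directions [u], [v].
    As matrices act from the right, its products are in the order opposite to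
    that of the composition of operators. *)
Definition curv_mx u v x : 'M[R]_n :=
  'D_u (conn v) x - 'D_v (conn u) x + conn v x *m conn u x - conn u x *m conn v x.

Lemma nabla_cst Y V : nabla g c (cst Y) (cst V) = fun x => V *m conn Y x.
Proof.
apply/funext => x; rewrite /nabla derive_cst add0r; apply/rowP => k.
rewrite !mxE exchange_big; apply: eq_bigr => j _; rewrite mxE mulr_sumr.
by apply: eq_bigr => i _; rewrite /cst; ring.
Qed.

Lemma nablaE (X : 'rV[R]_n) (Z : 'rV[R]_n -> 'rV[R]_n) x :
  nabla g c (cst X) Z x = 'D_X Z x + Z x *m conn X x.
Proof.
rewrite /nabla; congr (_ + _); apply/rowP => k.
rewrite !mxE exchange_big; apply: eq_bigr => j _; rewrite mxE mulr_sumr.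
by apply: eq_bigr => i _; rewrite /cst; ring.
Qed.

Lemma derivable_conn u v x : U x -> derivable (conn u) x v.
Proof. by move=> Ux; apply: smooth_derivable Ux; exact: smooth_conn. Qed.

Lemma derive_mull (V : 'rV[R]_n) u v x : U x ->
  'D_v (fun y => V *m conn u y) x = V *m 'D_v (conn u) x.
Proof. by move=> Ux; apply: derive_mulmxl; exact: derivable_conn. Qed.

Lemma curv_opE x X Y V : U x -> curv_op g c x X Y V = V *m curv_mx X Y x.
Proof.
move=> Ux; rewrite /curv_op /curv_field !nabla_cst !nablaE !derive_mull //.
have -> : lie_bracket (cst X) (cst Y) = cst 0.
  by apply/funext => y; rewrite /lie_bracket !derive_cst subrr.
rewrite nabla_cst (_ : conn 0 x = 0) ?mulmx0 ?subr0; last first.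
  by rewrite -[0](addNr 0) -[- 0]scaleN1r conn_linear scaleN1r addNr.
rewrite /curv_mx !mulmxBr !mulmxDr !mulmxN !mulmxA opprD addrACA -!addrA.
by congr (_ + _); rewrite addrCA.
Qed.

Lemma curv_mx_anti X Y x : curv_mx X Y x = - curv_mx Y X x.
Proof.
have aux (p q r s : 'M[R]_n) : p - q + r - s = - (q - p + s - r).
  by apply/matrixP => i j; rewrite !mx_lincombE; ring.
exact: aux.
Qed.

Lemma curv_mx_linear a X Y Z x : U x ->
  curv_mx (a *: X + Y) Z x = a *: curv_mx X Z x + curv_mx Y Z x.
Proof.
move=> Ux; rewrite /curv_mx conn_linear.
have dZ : differentiable (conn Z) x.
  by apply: smooth_differentiable Ux; exact: smooth_conn.
have -> : 'D_(a *: X + Y) (conn Z) x = a *: 'D_X (conn Z) x + 'D_Y (conn Z) x.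
  by rewrite !deriveE // linearP.
have -> : 'D_Z (conn (a *: X + Y)) x = a *: 'D_Z (conn X) x + 'D_Z (conn Y) x.
  have -> : conn (a *: X + Y) = (a *: conn X) + conn Y.
    by apply/funext => y; rewrite conn_linear.
  have d1 : derivable (conn X) x Z by exact: derivable_conn.
  have d2 : derivable (conn Y) x Z by exact: derivable_conn.
  by rewrite (deriveD (derivableZ d1) d2) (deriveZ _ d1).
exact: curv_expr_linear.
Qed.

Lemma conn_torsion_derive u v w x : U x ->
  v *m 'D_w (conn u) x = u *m 'D_w (conn v) x.
Proof.
move=> Ux; rewrite -(derive_mull v u w Ux) -(derive_mull u v w Ux).
apply: near_eq_derive; near=> y.
by apply: conn_torsion; near: y; exact: open_nbhs_nbhs.
Unshelve. all: by end_near. Qed.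

(** First Bianchi identity: the terms cancel in pairs by freeness of torsion,
    in itself and differentiated. *)
Lemma curv_mx_bianchi X Y Z x : U x ->
  Z *m curv_mx X Y x + X *m curv_mx Y Z x + Y *m curv_mx Z X x = 0.
Proof.
move=> Ux.
have T := fun u v w => conn_torsion_derive u v w Ux.
exact: curv_expr_bianchi (conn_torsion _ _ Ux) (conn_torsion _ _ Ux)
  (conn_torsion _ _ Ux) (T _ _ _) (T _ _ _) (T _ _ _).
Qed.

Lemma curv_mx_skew X Y x : U x ->
  curv_mx X Y x *m G x + G x *m (curv_mx X Y x)^T = 0.
Proof.
move=> Ux.
have dG v : derivable G x v by apply: smooth_derivable Ux; exact: gram_smooth.
have DD u v : 'D_u ('D_v G) x =
    'D_u (conn v) x *m G x + conn v x *m 'D_u G x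
    + ('D_u (conn v) x *m G x + conn v x *m 'D_u G x)^T.
  have dC : derivable (conn v) x u by exact: derivable_conn.
  have dP : derivable (fun y => conn v y *m G y) x u.
    apply: (@smooth_derivable R _ _ U); last exact: Ux.
    by apply: smooth_mulmx => //; [exact: smooth_conn|exact: gram_smooth].
  have E : \near x, 'D_v G x = conn v x *m G x + (conn v x *m G x)^T.
    near=> y; have Uy : U y by near: y; exact: open_nbhs_nbhs.
    by rewrite (conn_metric v Uy) trmx_mul gram_sym.
  rewrite (near_eq_derive u E).
  have dPt : derivable (fun y => (conn v y *m G y)^T) x u.
    apply: (@smooth_derivable R _ _ U); last exact: Ux.
    apply: smooth_trmx => //.
    by apply: smooth_mulmx => //; [exact: smooth_conn|exact: gram_smooth].
  by rewrite (deriveD dP dPt) (derive_trmx dP) (derive_mulmx dC (dG u)).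
have C := derive_comm_mx X Y oU (gram_smooth g c) Ux.
rewrite !DD !(conn_metric _ Ux) in C.
exact: curv_expr_skew (gram_sym g Ux) C.
Unshelve. all: by end_near. Qed.
End LeviCivita.

(** * Naturality of the curvature under changes of charts *)

Lemma koszul_transition_expr (R : realFieldType)
    (a a' p q r d1 d2 d3 x1 x2 y1 y2 z1 z2 : R) :
  2 * a = p + q - r -> 2 * a' = d1 + d2 - d3 ->
  p = x1 + d1 + x2 -> q = y1 + d2 + y2 -> r = z1 + d3 + z2 ->
  y1 = x1 -> z1 = x2 -> z2 = y2 -> a = a' + x1.
Proof. by move=> *; lra. Qed.

(** [H] is the common value of the second derivatives [D_u H_v] and [D_v H_u] of
    the Jacobian, and [Kh] the connection in the direction [u H_v = v H_u]: both
    disappear by antisymmetrisation, and the derivatives [Hu], [Hv] of the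
    Jacobian cancel against those in the transformation law of the connection. *)
Lemma curv_transition_expr (R : comPzRingType) (n : nat)
    (J Cu Cv Cuv Cvu Ku Kv Kuv Kvu Kh Hu Hv H : 'M[R]_n) :
  Cu *m J = J *m Ku + Hu -> Cv *m J = J *m Kv + Hv ->
  Cuv *m J + Cv *m Hu = Hu *m Kv + J *m (Kh + Kuv) + H ->
  Cvu *m J + Cu *m Hv = Hv *m Ku + J *m (Kh + Kvu) + H ->
  (Cuv - Cvu + Cv *m Cu - Cu *m Cv) *m J =
  J *m (Kuv - Kvu + Kv *m Ku - Ku *m Kv).
Proof.
move=> EU EV EUV EVU.
have {}EUV : Cuv *m J = Hu *m Kv + J *m (Kh + Kuv) + H - Cv *m Hu by rewrite -EUV addrK.
have {}EVU : Cvu *m J = Hv *m Ku + J *m (Kh + Kvu) + H - Cu *m Hv by rewrite -EVU addrK.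
rewrite !(mulmxDl, mulNmx) -!mulmxA EU EV !mulmxDr !mulmxA EU EV EUV EVU.
rewrite !(mulmxDl, mulmxDr, mulmxN) !mulmxA.
by apply/matrixP => i j; rewrite !mx_lincombE; ring.
Qed.

Section Transition.
Context {R : realType} {n : nat} {M : topologicalType}
  {A : smooth_manifold R n M} (g : riemannian_metric A) (c c' : chart A).
Local Notation phi := (transition c c').
Local Notation W := (chart_map c @` (chart_dom c `&` chart_dom c')).
Implicit Types (u v w X Y Z : 'rV[R]_n).

Lemma overlap_image x : W x -> image_of c x /\ image_of c' (phi x).
Proof.
case=> p [pc pc'] <-; split; first by exists p.
by exists p => //; rewrite /transition /= chart_mapK.
Qed.

Lemma overlap_open : open W.
Proof.
have -> : W = image_of c `&` [set x | image_of c x /\ chart_dom c' (chart_inv c x)].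
  apply/seteqP; split=> x /=.
    case=> p [pc pc'] <-; have ic : image_of c (chart_map c p) by exists p.
    by split=> //; split=> //; rewrite chart_mapK.
  case=> _ [[p pc <-]]; rewrite chart_mapK // => pc'; by exists p.
rewrite openE => x [[p pc <-] [_]]; rewrite chart_mapK // => pc'.
have oc : open (image_of c) by exact: chart_map_open.
have ic : image_of c (chart_map c p) by exists p.
rewrite /interior; near=> y.
have Uy : image_of c y by near: y; exact: open_nbhs_nbhs.
split=> //; split=> //; near: y.
apply: (chart_inv_continuous pc); rewrite chart_mapK //.
by apply: open_nbhs_nbhs; split=> //; exact: chart_dom_open.
Unshelve. all: by end_near. Qed.

Definition jac x : 'M[R]_n := jacobian phi x.

Let oW := overlap_open.

Let sphi : smooth_on W phi. Proof. exact: transition_smooth. Qed.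

Lemma diff_transition u x : W x -> 'd phi x u = u *m jac x.
Proof.
by move=> Wx; rewrite -deriveE ?deriveEjacobian //; exact: smooth_differentiable Wx.
Qed.

Lemma derive_transition u x : W x -> 'D_u phi x = u *m jac x.
Proof. by move=> Wx; rewrite deriveEjacobian //; exact: smooth_differentiable Wx. Qed.

Lemma smooth_jac : smooth_on W jac.
Proof.
apply/(smooth_mxP oW) => i j.
have sD := (smooth_mxP oW _).1 (smooth_derive (delta_mx 0 i) sphi).
apply: (smooth_eq oW _ (sD 0 j)) => x Wx.
by rewrite derive_transition // -rowE mxE.
Qed.

Let dJ v x : W x -> derivable jac x v.
Proof. by move=> Wx; apply: smooth_derivable Wx; exact: smooth_jac. Qed.

Lemma derive_mul_jac u v x : W x ->
  'D_v (fun y => u *m jac y) x = u *m 'D_v jac x.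
Proof.
by move=> Wx; apply: derive_mulmxl; exact: dJ.
Qed.

(** Schwarz's theorem for the transition map, whose second derivative is the
    derivative of its Jacobian. *)
Lemma second_derivative_sym u v x : W x -> u *m 'D_v jac x = v *m 'D_u jac x.
Proof.
move=> Wx.
have E a b : 'D_b ('D_a phi) x = a *m 'D_b jac x.
  rewrite -derive_mul_jac //; apply: near_eq_derive; near=> y.
  by apply: derive_transition; near: y; exact: open_nbhs_nbhs.
by rewrite -!E; exact: derive_comm_mx oW sphi Wx.
Unshelve. all: by end_near. Qed.

Lemma derive_comp_transition (V : normedModType R) (F : 'rV[R]_n -> V) u x :
  W x -> differentiable F (phi x) ->
  'D_u (F \o phi) x = 'D_(u *m jac x) F (phi x).
Proof.
move=> Wx dF; have dp : differentiable phi x by exact: smooth_differentiable Wx.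
by apply: etrans (derive_comp u dp dF) _; rewrite derive_transition.
Qed.

Lemma gram_transitionE x : W x ->
  gram g c x = jac x *m gram g c' (phi x) *m (jac x)^T.
Proof.
move=> Wx; apply: bilin_inj => u v; rewrite bilin_mul -!diff_transition //.
case: (Wx) => p [pc pc'] <-.
by rewrite (gram_transition g pc pc') /transition /= chart_mapK.
Qed.

(** The Gram matrix of the first chart is a product in which the Jacobian is a
    factor. *)
Lemma jac_unit x : W x -> jac x \in unitmx.
Proof.
move=> Wx; have [ic _] := overlap_image Wx.
have := gram_unit g ic; rewrite gram_transitionE // !unitmx_mul.
by case/andP => /andP[].
Qed.

Lemma derive_gram_transition u x : W x ->
  'D_u (gram g c) x =
    'D_u jac x *m gram g c' (phi x) *m (jac x)^T
  + jac x *m 'D_(u *m jac x) (gram g c') (phi x) *m (jac x)^T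
  + jac x *m gram g c' (phi x) *m ('D_u jac x)^T.
Proof.
move=> Wx; have [_ ic'] := overlap_image Wx.
have E : \near x, gram g c x = jac x *m (gram g c' \o phi) x *m (jac x)^T.
  by near=> y; apply: gram_transitionE; near: y; exact: open_nbhs_nbhs.
have dG : differentiable (gram g c') (phi x).
  by apply: smooth_differentiable ic'; exact: gram_smooth.
have dGp : derivable (gram g c' \o phi) x u.
  apply/diff_derivable/differentiable_comp => //.
  exact: smooth_differentiable Wx.
have dJx : derivable jac x u by exact: dJ.
have dJt : derivable (fun y => (jac y)^T) x u.
  by apply: smooth_derivable Wx; apply: smooth_trmx => //; exact: smooth_jac.
have dJG := derivable_mulmx dJx dGp.
rewrite (near_eq_derive u E) (derive_mulmx dJG dJt) (derive_mulmx dJx dGp).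
by rewrite (derive_trmx dJx) derive_comp_transition // mulmxDl.
Unshelve. all: by end_near. Qed.

Lemma bilin_derive_gram_transition u v w x : W x ->
  bilin ('D_u (gram g c) x) v w =
    bilin (gram g c' (phi x)) (v *m 'D_u jac x) (w *m jac x)
  + bilin ('D_(u *m jac x) (gram g c') (phi x)) (v *m jac x) (w *m jac x)
  + bilin (gram g c' (phi x)) (v *m jac x) (w *m 'D_u jac x).
Proof. by move=> Wx; rewrite (derive_gram_transition u Wx) !bilinDm !bilin_mul. Qed.

(** Both sides are compared through Koszul's formula in the two charts. The
    derivatives of the Jacobian enter it six times, and by their symmetry all
    these terms but two cancel. *)
Lemma conn_transition u x : W x ->
  conn g c u x *m jac x = jac x *m conn g c' (u *m jac x) (phi x) + 'D_u jac x.
Proof.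
move=> Wx; have [ic ic'] := overlap_image Wx.
have sG' : (gram g c' (phi x))^T = gram g c' (phi x) by exact: gram_sym.
suff E : conn g c u x *m gram g c x =
    (jac x *m conn g c' (u *m jac x) (phi x) + 'D_u jac x)
      *m gram g c' (phi x) *m (jac x)^T.
  have uJ : (jac x)^T \in unitmx by rewrite unitmx_tr jac_unit.
  have uG' : gram g c' (phi x) \in unitmx by exact: gram_unit.
  apply: (can_inj (mulmxK uG')); apply: (can_inj (mulmxK uJ)).
  by rewrite -E -!mulmxA; congr (_ *m _); rewrite gram_transitionE // mulmxA.
apply: bilin_inj => v w.
rewrite bilin_mul mulmxDr bilinDl mulmxA -[in X in X + _]bilin_mull.
have H a b := second_derivative_sym a b Wx.
apply: koszul_transition_expr (koszul g u v w ic)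
  (koszul g (u *m jac x) (v *m jac x) (w *m jac x) ic')
  (bilin_derive_gram_transition u v w Wx) (bilin_derive_gram_transition v u w Wx)
  (bilin_derive_gram_transition w u v Wx) _ _ _.
- by rewrite (H u v).
- by rewrite (H u w) -bilin_tr sG'.
- by rewrite (H v w).
Qed.

Lemma derive_conn_transition a b x : W x ->
  is_derive x a (fun y => conn g c' (b *m jac y) (phi y))
    (conn g c' (b *m 'D_a jac x) (phi x)
     + 'D_(a *m jac x) (conn g c' (b *m jac x)) (phi x)).
Proof.
move=> Wx; have [ic ic'] := overlap_image Wx.
set F := fun y => _.
(* torsion-freeness moves the varying argument of the connection to the left
   of a matrix product *)
have FE w : \near x, w *m F x = (b *m jac x) *m (conn g c' w \o phi) x.
  near=> y; apply: conn_torsion.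
  by have [] : image_of c y /\ image_of c' (phi y)
    by apply: overlap_image; near: y; exact: open_nbhs_nbhs.
have dbJ : derivable (fun y => b *m jac y) x a.
  exact: (@derivable_mulmx R _ _ _ _ (cst b) jac x a (derivable_cst _ _ _) (@dJ a x Wx)).
have dCd w : differentiable (conn g c' w) (phi x).
  by apply: smooth_differentiable ic'; exact: smooth_conn.
have dC w : derivable (conn g c' w \o phi) x a.
  apply/diff_derivable/differentiable_comp; last exact: dCd.
  exact: smooth_differentiable Wx.
have dwF w : derivable (fun y => w *m F y) x a.
  apply: near_eq_derivable (derivable_mulmx dbJ (dC w)).
  by apply: filterS (FE w) => y ->.
have dF : derivable F x a.
  apply/derivable_mxP => i j.
  have -> : (fun y => F y i j) = (fun y => ((delta_mx 0 i : 'rV_n) *m F y) 0 j).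
    by apply/funext => y; rewrite -rowE [RHS]mxE.
  exact: (derivable_mxP _ _ _).1 (dwF (delta_mx 0 i)) 0 j.
apply: DeriveDef => //.
apply/row_matrixP => i; rewrite !rowE; set w := delta_mx 0 i.
rewrite -(derive_mulmxl w dF).
rewrite (near_eq_derive a (FE w)) (derive_mulmx dbJ (dC w)) (derive_mul_jac b a Wx).
rewrite (derive_comp_transition a Wx (dCd w)) mulmxDr.
by rewrite (conn_torsion g _ w ic') (conn_torsion_derive g _ w _ ic').
Unshelve. all: by end_near. Qed.

(** Tensoriality of the curvature, by differentiating the transformation law of
    the connection once more. *)
Lemma curv_mx_transition u v x : W x ->
  curv_mx g c u v x *m jac x =
  jac x *m curv_mx g c' (u *m jac x) (v *m jac x) (phi x).
Proof.
move=> Wx; have [ic ic'] := overlap_image Wx.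
have D a b : 'D_a (conn g c b) x *m jac x + conn g c b x *m 'D_a jac x =
   'D_a jac x *m conn g c' (b *m jac x) (phi x) +
   jac x *m (conn g c' (b *m 'D_a jac x) (phi x)
             + 'D_(a *m jac x) (conn g c' (b *m jac x)) (phi x))
   + 'D_a ('D_b jac) x.
  have [dF EF] := derive_conn_transition a b Wx.
  have dC : derivable (conn g c b) x a by exact: derivable_conn.
  have dD : derivable ('D_b jac) x a.
    apply: (@smooth_derivable R _ _ W); last exact: Wx.
    by apply: smooth_derive; exact: smooth_jac.
  rewrite -(derive_mulmx dC (@dJ a x Wx)) -EF -(derive_mulmx (@dJ a x Wx) dF).
  rewrite -(deriveD (derivable_mulmx (@dJ a x Wx) dF) dD).
  apply: near_eq_derive; near=> y; apply: conn_transition.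
  by near: y; exact: open_nbhs_nbhs.
have E := D v u; rewrite (second_derivative_sym u v Wx) in E.
rewrite (derive_comm_mx v u oW smooth_jac Wx) in E.
exact: curv_transition_expr (conn_transition u Wx) (conn_transition v Wx) (D u v) E.
Unshelve. all: by end_near. Qed.

Lemma inner_transition u v x : W x ->
  inner g c x u v = inner g c' (phi x) (u *m jac x) (v *m jac x).
Proof. by move=> Wx; rewrite /inner (gram_transitionE Wx) bilin_mul. Qed.

Lemma curv_transition X Y Z T x : W x ->
  curv g c x X Y Z T =
  curv g c' (phi x) (X *m jac x) (Y *m jac x) (Z *m jac x) (T *m jac x).
Proof.
move=> Wx; have [ic ic'] := overlap_image Wx.
rewrite /curv (curv_opE g _ _ _ ic) (curv_opE g _ _ _ ic') (inner_transition _ _ Wx).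
by rewrite -!mulmxA (curv_mx_transition X Y Wx).
Qed.

End Transition.

(** * The second Bianchi identity *)

(** The Jacobi identity for the three operators [D_X + conn X], written out;
    [xyz] stands for the second derivative [D_X (D_Y (conn Z))]. *)
Lemma curv_expr_bianchi2 (R : comPzRingType) (n : nat)
    (X Y Z xy xz yx yz zx zy xyz yxz yzx zyx xzy zxy : 'M[R]_n) :
  xyz = yxz -> yzx = zyx -> zxy = xzy ->
  (xyz - xzy + (xz *m Y + Z *m xy) - (xy *m Z + Y *m xz)
   + (yz - zy + Z *m Y - Y *m Z) *m X - X *m (yz - zy + Z *m Y - Y *m Z)) +
  (yzx - yxz + (yx *m Z + X *m yz) - (yz *m X + Z *m yx)
   + (zx - xz + X *m Z - Z *m X) *m Y - Y *m (zx - xz + X *m Z - Z *m X)) +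
  (zxy - zyx + (zy *m X + Y *m zx) - (zx *m Y + X *m zy)
   + (xy - yx + Y *m X - X *m Y) *m Z - Z *m (xy - yx + Y *m X - X *m Y)) = 0.
Proof.
move=> -> -> ->.
rewrite !(mulmxDl, mulmxDr, mulNmx, mulmxN) !mulmxA.
by apply/matrixP => i j; rewrite !mx_lincombE; ring.
Qed.

Lemma schur_term (R : comPzRingType) (n : nat) (G C : 'M[R]_n)
    (Y Z : 'rV[R]_n) (k d : R) :
  d *: (G *m (Z^T *m Y - Y^T *m Z)) + k *: ((C *m G + G *m C^T) *m (Z^T *m Y - Y^T *m Z))
   + k *: (G *m (Z^T *m Y - Y^T *m Z)) *m C - C *m (k *: (G *m (Z^T *m Y - Y^T *m Z))) =
  G *m (d *: (Z^T *m Y - Y^T *m Z) +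
    k *: ((Z *m C)^T *m Y - (Y *m C)^T *m Z + (Z^T *m (Y *m C) - Y^T *m (Z *m C)))).
Proof.
have -> : (Z *m C)^T *m Y - (Y *m C)^T *m Z + (Z^T *m (Y *m C) - Y^T *m (Z *m C)) =
    C^T *m (Z^T *m Y - Y^T *m Z) + (Z^T *m Y - Y^T *m Z) *m C.
  by rewrite !trmx_mul mulmxBr mulmxBl !mulmxA.
move: (Z^T *m Y - Y^T *m Z) => P.
rewrite mulmxDr -!scalemxAr -!scalemxAl mulmxDr mulmxDl !mulmxA.
by apply/matrixP => i j; rewrite !mx_lincombE; ring.
Qed.

Lemma schur_expr (R : comPzRingType) (n : nat) (CX CY CZ : 'M[R]_n)
    (X Y Z : 'rV[R]_n) (k dX dY dZ : R) :
  Z *m CX = X *m CZ -> Y *m CX = X *m CY -> Z *m CY = Y *m CZ ->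
  (dX *: (Z^T *m Y - Y^T *m Z) +
    k *: ((Z *m CX)^T *m Y - (Y *m CX)^T *m Z + (Z^T *m (Y *m CX) - Y^T *m (Z *m CX)))) +
  (dY *: (X^T *m Z - Z^T *m X) +
    k *: ((X *m CY)^T *m Z - (Z *m CY)^T *m X + (X^T *m (Z *m CY) - Z^T *m (X *m CY)))) +
  (dZ *: (Y^T *m X - X^T *m Y) +
    k *: ((Y *m CZ)^T *m X - (X *m CZ)^T *m Y + (Y^T *m (X *m CZ) - X^T *m (Y *m CZ)))) =
  dX *: (Z^T *m Y - Y^T *m Z) + dY *: (X^T *m Z - Z^T *m X) + dZ *: (Y^T *m X - X^T *m Y).
Proof.
move=> -> -> ->; move: (X *m CZ) (X *m CY) (Y *m CZ) => b c a.
by apply/matrixP => i j; rewrite !mx_lincombE; ring.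
Qed.

Section Schur.
Context {R : realType} {n : nat} {M : topologicalType}
  {A : smooth_manifold R n M} (g : riemannian_metric A) (c : chart A).
Local Notation U := (image_of c).
Local Notation G := (gram g c).
Local Notation conn := (conn g c).
Local Notation curv_mx := (curv_mx g c).
Implicit Types (u v w X Y Z : 'rV[R]_n).

Let oU : open U. Proof. exact: chart_map_open. Qed.

Lemma smooth_curv_mx X Y : smooth_on U (curv_mx X Y).
Proof.
have sD u v : smooth_on U ('D_u (conn v)) by apply: smooth_derive; exact: smooth_conn.
have sM u v : smooth_on U (fun x => conn u x *m conn v x).
  by apply: smooth_mulmx => //; exact: smooth_conn.
apply: smooth_mxB => //; apply: smoothD => //; exact: smooth_mxB.
Qed.

Lemma derive_curv_mx X Y Z x : U x ->
  'D_X (curv_mx Y Z) x = 'D_X ('D_Y (conn Z)) x - 'D_X ('D_Z (conn Y)) x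
    + ('D_X (conn Z) x *m conn Y x + conn Z x *m 'D_X (conn Y) x)
    - ('D_X (conn Y) x *m conn Z x + conn Y x *m 'D_X (conn Z) x).
Proof.
move=> Ux.
have dC u v : derivable (conn u) x v by exact: derivable_conn.
have dD u v : derivable ('D_u (conn v)) x X.
  apply: (@smooth_derivable R _ _ U); last exact: Ux.
  by apply: smooth_derive; exact: smooth_conn.
have dM u v : derivable (fun y => conn u y *m conn v y) x X by exact: derivable_mulmx.
rewrite (deriveB (derivableD (derivableB (dD Y Z) (dD Z Y)) (dM Z Y)) (dM Y Z)).
rewrite (deriveD (derivableB (dD Y Z) (dD Z Y)) (dM Z Y)) (deriveB (dD Y Z) (dD Z Y)).
by rewrite (derive_mulmx (dC Z X) (dC Y X)) (derive_mulmx (dC Y X) (dC Z X)).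
Qed.

Lemma curv_mx_bianchi2 X Y Z x : U x ->
  ('D_X (curv_mx Y Z) x + curv_mx Y Z x *m conn X x - conn X x *m curv_mx Y Z x) +
  ('D_Y (curv_mx Z X) x + curv_mx Z X x *m conn Y x - conn Y x *m curv_mx Z X x) +
  ('D_Z (curv_mx X Y) x + curv_mx X Y x *m conn Z x - conn Z x *m curv_mx X Y x) = 0.
Proof.
move=> Ux; rewrite !(derive_curv_mx _ _ _ Ux).
have C u v w := derive_comm_mx u v oU (smooth_conn g c w) Ux.
exact: curv_expr_bianchi2 (C X Y Z) (C Y Z X) (C Z X Y).
Qed.

(** Schur's lemma, pointwise form: if the curvature is [k] times that of a unit
    sphere, the second Bianchi identity reads
    [dk(X) Y/\Z + dk(Y) Z/\X + dk(Z) X/\Y = 0]. *)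
Lemma schur_bianchi (k : 'rV[R]_n -> R) X Y Z x : U x ->
  differentiable k x ->
  (forall y, U y -> forall u v,
     curv_mx u v y = k y *: (G y *m (v^T *m u - u^T *m v))) ->
  'D_X k x *: (Z^T *m Y - Y^T *m Z) + 'D_Y k x *: (X^T *m Z - Z^T *m X)
    + 'D_Z k x *: (Y^T *m X - X^T *m Y) = 0.
Proof.
move=> Ux dk kE.
have D u v w : 'D_w (curv_mx u v) x = 'D_w k x *: (G x *m (v^T *m u - u^T *m v))
   + k x *: ((conn w x *m G x + G x *m (conn w x)^T) *m (v^T *m u - u^T *m v)).
  have E : \near x, curv_mx u v x = k x *: (G x *m (v^T *m u - u^T *m v)).
    by near=> y; apply: kE; near: y; exact: open_nbhs_nbhs.
  have dk' : derivable k x w by exact: diff_derivable.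
  have dG : derivable G x w by apply: smooth_derivable Ux; exact: gram_smooth.
  have dN : derivable (cst (v^T *m u - u^T *m v)) x w by exact: derivable_cst.
  rewrite (near_eq_derive w E) (derive_scalemx dk' (derivable_mulmx dG dN)).
  by rewrite (derive_mulmx dG dN) derive_cst mulmx0 addr0 (conn_metric g w Ux).
have B := curv_mx_bianchi2 X Y Z Ux.
rewrite !D !(kE x Ux) !schur_term -!mulmxDr in B.
have T u v := conn_torsion g u v Ux.
rewrite (schur_expr _ _ _ _ (T X Z) (T X Y) (T Y Z)) in B.
by apply: (can_inj (mulKmx (gram_unit g Ux))); rewrite B mulmx0.
Unshelve. all: by end_near. Qed.

End Schur.

(** * Algebraic curvature tensors in dimension 3 *)

Section CrossProduct.
Context {R : realType}.
Implicit Types (a b c d z : 'rV[R]_3) (B C : 'M[R]_3).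

Lemma sum3 (V : nmodType) (f : 'I_3 -> V) : \sum_i f i = f 0 + f 1 + f 2.
Proof.
rewrite !big_ord_recr big_ord0 /= add0r.
by congr (f _ + f _ + f _); apply: val_inj.
Qed.

Lemma ord3_add :
  (((0 + 1)%R = 1 :> 'I_3) * ((1 + 1)%R = 2 :> 'I_3) * ((2 + 1)%R = 0 :> 'I_3)
  * ((0 + 2)%R = 2 :> 'I_3) * ((1 + 2)%R = 0 :> 'I_3) * ((2 + 2)%R = 1 :> 'I_3))%type.
Proof. by do !split; apply: val_inj. Qed.

Lemma ord3P (P : 'I_3 -> Prop) : P 0 -> P 1 -> P 2 -> forall i, P i.
Proof.
move=> P0 P1 P2 [[|[|[|//]]] Hi].
- by rewrite (_ : Ordinal Hi = 0) //; apply: val_inj.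
- by rewrite (_ : Ordinal Hi = 1) //; apply: val_inj.
- by rewrite (_ : Ordinal Hi = 2) //; apply: val_inj.
Qed.

Lemma row3P a b : a 0 0 = b 0 0 -> a 0 1 = b 0 1 -> a 0 2 = b 0 2 -> a = b.
Proof. by move=> h0 h1 h2; apply/rowP; apply: ord3P. Qed.

(** Indices are added modulo 3. *)
Definition cross a b : 'rV[R]_3 :=
  \row_k (a 0 (k + 1) * b 0 (k + 2) - a 0 (k + 2) * b 0 (k + 1)).

Lemma crossE a b :
  ((cross a b 0 0 = (a 0 1 * b 0 2 - a 0 2 * b 0 1)%R) *
   (cross a b 0 1 = (a 0 2 * b 0 0 - a 0 0 * b 0 2)%R) *
   (cross a b 0 2 = (a 0 0 * b 0 1 - a 0 1 * b 0 0)%R))%type.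
Proof. by do !split; rewrite mxE !ord3_add. Qed.

Lemma dot3E a b : (a *m b^T) 0 0 = a 0 0 * b 0 0 + a 0 1 * b 0 1 + a 0 2 * b 0 2.
Proof. by rewrite mxE sum3 !mxE. Qed.

Local Notation e k := (delta_mx 0 k : 'rV[R]_3).

(** An alternating form on a 3-dimensional space is a linear form on bivectors,
    that is, on the values of the cross product. *)
Lemma alternating_cross (f : 'rV[R]_3 -> 'rV[R]_3 -> R) :
  (forall x a b c, f (x *: a + b) c = x * f a c + f b c) ->
  (forall a b, f a b = - f b a) ->
  forall a b, f a b = \sum_k cross a b 0 k * f (e (k + 1)) (e (k + 2)).
Proof.
move=> fl fa a b.
have f0 c : f 0 c = 0 by have := fl (-1) 0 0 c; rewrite scaleN1r addr0 oppr0 mulN1r addNr.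
have fD c d w : f (c + d) w = f c w + f d w by rewrite -[c]scale1r fl mul1r scale1r.
have fZ x c w : f (x *: c) w = x * f c w by rewrite -[x *: c]addr0 fl f0 addr0.
have fsum c w : f c w = c 0 0 * f (e 0) w + c 0 1 * f (e 1) w + c 0 2 * f (e 2) w.
  by rewrite {1}[c]row_sum_delta sum3 !fD !fZ.
have faa c : f c c = 0.
  apply/eqP; rewrite -[_ == 0](mulrn_eq0 _ 2) mulr2n; apply/eqP.
  by rewrite {1}fa addNr.
rewrite sum3 !crossE !ord3_add fsum (fa (e 0) b) (fa (e 1) b) (fa (e 2) b).
rewrite (fsum b (e 0)) (fsum b (e 1)) (fsum b (e 2)) !faa.
rewrite (fa (e 2) (e 1)) (fa (e 1) (e 0)) (fa (e 0) (e 2)); ring.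
Qed.

Record curvature_like (K : 'rV[R]_3 -> 'rV[R]_3 -> 'rV[R]_3 -> 'rV[R]_3 -> R) := {
  curvature_linear : forall x a b c d w, K (x *: a + b) c d w = x * K a c d w + K b c d w;
  curvature_linear3 : forall x a b c d w, K c d (x *: a + b) w = x * K c d a w + K c d b w;
  curvature_anti12 : forall a b c d, K a b c d = - K b a c d;
  curvature_anti34 : forall a b c d, K a b c d = - K a b d c;
  curvature_bianchi : forall a b c d, K a b c d + K b c a d + K c a b d = 0 }.

(** A combination of the four Bianchi identities on [a, b, c, d]. *)
Lemma curvature_pair_sym K : curvature_like K -> forall a b c d, K a b c d = K c d a b.
Proof.
case=> _ _ A1 A2 B a b c d.
have := B a b c d; have := B b c d a; have := B c d a b; have := B d a b c.
rewrite (A1 c a b d) (A2 b c d a) (A2 c d b a) (A1 d b c a) (A2 b d c a).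
rewrite (A1 d a c b) (A2 a d c b) (A2 a c d b) (A1 d a b c) (A2 a b d c).
lra.
Qed.

(** The curvature operator on bivectors, these being identified with vectors
    by the cross product; the sign makes its diagonal entries the sectional
    curvatures of the coordinate planes. *)
Definition curvature_operator (K : 'rV[R]_3 -> 'rV[R]_3 -> 'rV[R]_3 -> 'rV[R]_3 -> R) : 'M[R]_3 :=
  \matrix_(k, l) - K (e (k + 1)) (e (k + 2)) (e (l + 1)) (e (l + 2)).


Lemma curvature_operatorE K : curvature_like K -> forall a b c d,
  K a b c d = - bilin (curvature_operator K) (cross a b) (cross c d).
Proof.
move=> HK a b c d; rewrite bilinE -sumrN.
rewrite (@alternating_cross (fun a b => K a b c d)); last 2 first.
- by move=> x a' b' c'; rewrite (curvature_linear HK).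
- by move=> a' b'; rewrite (curvature_anti12 HK).
apply: eq_bigr => k _.
rewrite (@alternating_cross (fun c d => K _ _ c d)); last 2 first.
- by move=> x a' b' c'; rewrite (curvature_linear3 HK).
- by move=> a' b'; rewrite (curvature_anti34 HK).
rewrite mulr_sumr -sumrN; apply: eq_bigr => l _; rewrite [curvature_operator K k l]mxE; ring.
Qed.

Lemma curvature_operator_sym K : curvature_like K ->
  (curvature_operator K)^T = curvature_operator K.
Proof. by move=> HK; apply/matrixP => i j; rewrite !mxE curvature_pair_sym. Qed.

(** Hence in dimension 3 the Ricci form determines the curvature operator. *)
Lemma ricci_curvature_operator K : curvature_like K ->
  \matrix_(i, j) \sum_t K (e i) (e t) (e t) (e j) =
  (\tr (curvature_operator K))%:M - curvature_operator K.
Proof.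
move=> HK; have Bs := curvature_operator_sym HK; have KE := curvature_operatorE HK.
move: (curvature_operator K) Bs KE => B Bs KE.
have S i j : B i j = B j i by rewrite -{1}Bs mxE.
apply/matrixP => i j; rewrite !mxE.
under eq_bigr do rewrite KE bilinE.
rewrite /mxtrace !sum3 !crossE; move: i j; apply: ord3P; apply: ord3P;
  rewrite !mxE /= ?(S 1 0) ?(S 2 0) ?(S 2 1); ring.
Qed.

(** The form [B] derived by the infinitesimal rotation [cross^~ z], as the
    curvature tensor is derived in R.R and in the Tachibana tensor. *)
Definition rotate B z a b := bilin B (cross a z) b + bilin B a (cross b z).

(** Rotations act on bivectors as on vectors. *)
Lemma cross_derivation a b z : cross (cross a z) b + cross a (cross b z) = cross (cross a b) z.
Proof. by apply: row3P; rewrite mx_addE !crossE; ring. Qed.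

Lemma cross_cross a b c :
  (b *m c^T) 0 0 *: a - (a *m c^T) 0 0 *: b = cross c (cross a b).
Proof.
by rewrite !dot3E; apply: row3P; rewrite !mx_lincombE !crossE; ring.
Qed.

(** The dot product is invariant under rotations. *)
Lemma rotate_scalar B x z a b : rotate (B - x%:M) z a b = rotate B z a b.
Proof.
have E u v : bilin (B - x%:M) u v = bilin B u v - x * (u *m v^T) 0 0.
  by rewrite bilinDm bilinNm /bilin mul_mx_scalar -scalemxAl mx_scaleE.
rewrite /rotate !E.
have -> : (cross a z *m b^T) 0 0 = - (a *m (cross b z)^T) 0 0.
  by rewrite !dot3E !crossE; ring.
ring.
Qed.

Lemma rotateB B x z w a b :
  rotate B (z - x *: w) a b = rotate B z a b - x * rotate B w a b.
Proof.
have E c : cross c (z - x *: w) = cross c z + (- x) *: cross c w.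
  by apply: row3P; rewrite !mx_lincombE !crossE !mx_lincombE; ring.
rewrite /rotate !E !bilinDl !bilinDr !bilinZl !bilinZr; ring.
Qed.

Lemma rotate_basis B z : B^T = B ->
  (rotate B z (e 1) (e 1) = 2 * (z 0 2 * B 0 1 - z 0 0 * B 1 2)) /\
  (rotate B z (e 0) (e 1) =
     - z 0 2 * B 1 1 + z 0 1 * B 1 2 + z 0 2 * B 0 0 - z 0 0 * B 0 2) /\
  (rotate B z (e 0) (e 2) =
     - z 0 2 * B 1 2 + z 0 1 * B 2 2 - z 0 1 * B 0 0 + z 0 0 * B 0 1) /\
  (rotate B z (e 1) (e 2) =
     z 0 2 * B 0 2 - z 0 0 * B 2 2 - z 0 1 * B 0 1 + z 0 0 * B 1 1).
Proof.
move=> Bs; have S i j : B i j = B j i by rewrite -{1}Bs mxE.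
rewrite /rotate !bilinE !sum3 !crossE !mxE /= (S 1 0) (S 2 0) (S 2 1).
by do !split; ring.
Qed.

(** Evaluated on basis vectors, the hypothesis says that the off-diagonal
    2x2 minors of [C] vanish and that the principal ones agree, i.e. that the
    adjugate of [C] is a scalar. If this scalar is nonzero then [C], which is
    proportional to the inverse of its adjugate, is a scalar; otherwise all
    minors vanish. *)
Lemma rotate_self_alternative C : C^T = C ->
  (forall w a b, rotate C (w *m C) a b = 0) ->
  (exists x, C = x%:M) \/ (forall k i j, C i j * C k k = C i k * C k j).
Proof.
move=> Cs H; have S i j : C i j = C j i by rewrite -{1}Cs mxE.
have Z k l : (e k *m C) 0 l = C k l by rewrite -rowE mxE.
have [E1 [E2 [E3 E4]]] := rotate_basis (e 0 *m C) Cs.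
have [_ [_ [E5 _]]] := rotate_basis (e 1 *m C) Cs.
rewrite !H !Z !(S 1 0) in E1 E2 E3 E4 E5.
have M1 : C 0 0 * C 1 2 = C 0 1 * C 0 2 by lra.
have M2 : C 0 1 * C 1 2 = C 0 2 * C 1 1 by lra.
have M3 : C 0 1 * C 2 2 = C 0 2 * C 1 2 by lra.
have D1 : C 0 0 * C 1 1 - C 0 1 * C 0 1 = C 0 0 * C 2 2 - C 0 2 * C 0 2 by lra.
have D2 : C 0 0 * C 1 1 - C 0 1 * C 0 1 = C 1 1 * C 2 2 - C 1 2 * C 1 2 by lra.
have [m0|m0] := eqVneq (C 0 0 * C 1 1 - C 0 1 * C 0 1) 0.
  right; rewrite m0 in D1 D2.
  by do 3 apply: ord3P; rewrite ?(S 1 0) ?(S 2 0) ?(S 2 1); lra.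
left; exists (C 0 0).
have c01 : C 0 1 = 0.
  apply: (mulIf m0); rewrite mul0r.
  transitivity (C 0 2 * (C 0 0 * C 1 2 - C 0 1 * C 0 2)); last by rewrite M1; ring.
  rewrite D1; transitivity (C 0 0 * (C 0 1 * C 2 2) - C 0 1 * C 0 2 * C 0 2); first by ring.
  rewrite M3; ring.
have c02 : C 0 2 = 0.
  apply: (mulIf m0); rewrite mul0r.
  transitivity (C 0 0 * (C 0 2 * C 1 1) - C 0 1 * C 0 1 * C 0 2); first by ring.
  rewrite -M2; transitivity (C 0 1 * (C 0 0 * C 1 2 - C 0 1 * C 0 2)); first by ring.
  rewrite M1; ring.
rewrite c01 c02 !mulr0 !subr0 in m0 D1 D2 M1.
have [c00 c11] : C 0 0 != 0 /\ C 1 1 != 0 by apply/andP; rewrite -negb_or -mulf_eq0.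
have c12 : C 1 2 = 0 by apply: (mulfI c00); rewrite M1 mulr0.
rewrite c12 mulr0 subr0 in D2.
have e12 : C 1 1 = C 2 2 by exact: mulfI c00 _ _ D1.
have e02 : C 0 0 = C 2 2 by apply: (mulfI c11); rewrite -D2 mulrC.
by apply/matrixP; do 2 apply: ord3P; rewrite !mxE /= ?(S 1 0) ?(S 2 0) ?(S 2 1)
  ?mulr1n ?mulr0n ?e12 ?e02 // ?e02.
Qed.

Lemma sqr_sym_eq0 C : C^T = C -> C *m C = 0 -> C = 0.
Proof.
move=> Cs CC; apply/matrixP => i j; rewrite mxE.
have := congr1 (fun D : 'M[R]_3 => D i i) CC; rewrite !mxE => /eqP.
rewrite psumr_eq0; last first.
  by move=> k _; rewrite -{1}Cs mxE -expr2 sqr_ge0.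
move=> /allP /(_ j (mem_index_enum _)) /=.
by rewrite -{1}Cs mxE mulf_eq0 orbb => /eqP; rewrite -{1}Cs mxE.
Qed.

(** The trace cannot vanish unless [C] does, a symmetric matrix of square zero
    being zero. *)
Lemma rank_one_sym C : C^T = C -> (forall k i j, C i j * C k k = C i k * C k j) ->
  C = 0 \/ [/\ \tr C != 0, C *m C = \tr C *: C & \rank C = 1].
Proof.
move=> Cs CC.
have C2 : C *m C = \tr C *: C.
  apply/matrixP => i j; rewrite !mxE /mxtrace mulr_suml; apply: eq_bigr => k _.
  by rewrite -CC mulrC.
have [t0|t0] := eqVneq (\tr C) 0.
  by left; apply: sqr_sym_eq0 => //; rewrite C2 t0 scale0r.
right; split=> //.
have [k ck] : exists k, C k k != 0.
  apply/existsP; apply: contraNT t0; rewrite negb_exists => /forallP c0.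
  by apply/eqP; apply: big1 => k _; apply/eqP; rewrite -[_ == _]negbK.
apply/eqP; rewrite eqn_leq; apply/andP; split; last first.
  rewrite lt0n mxrank_eq0; apply: contraNneq ck => -> ; by rewrite mxE.
have -> : C = (C k k)^-1 *: (col k C *m row k C).
  apply/matrixP => i j; rewrite !mxE big_ord1 !mxE -CC mulrC -mulrA divff ?mulr1 //.
apply: leq_trans (mxrank_scale _ _) _.
by apply: leq_trans (mxrankM_maxl _ _) _; exact: rank_leq_col.
Qed.

(** By invariance of the dot product the hypothesis is a condition on [B - L]
    alone, that of [rotate_self_alternative]. *)
Lemma rotate_alternative B L : B^T = B ->
  (forall w a b, rotate B (w *m B) a b = L * rotate B w a b) ->
  (exists x, B = x%:M) \/
  (let C := B - L%:M in [/\ \tr C != 0, C *m C = \tr C *: C & \rank C = 1]).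
Proof.
move=> Bs H.
have Cs : (B - L%:M)^T = B - L%:M by rewrite linearB /= Bs tr_scalar_mx.
have HC w a b : rotate (B - L%:M) (w *m (B - L%:M)) a b = 0.
  by rewrite rotate_scalar mulmxBr mul_mx_scalar rotateB H subrr.
have [[x Cx]|CC] := rotate_self_alternative Cs HC.
  by left; exists (x + L); rewrite raddfD /= -Cx subrK.
have [C0|] := rank_one_sym Cs CC; last by right.
by left; exists L; apply/eqP; rewrite -subr_eq0 C0.
Qed.

(** [w *m B] and [L *: w] differ by a multiple of [e 0], and the rotations about
    [e 0] preserve [B]. *)
Lemma rotate_axial B L : B^T = B -> B 0 1 = 0 -> B 0 2 = 0 -> B 1 2 = 0 ->
  B 1 1 = L -> B 2 2 = L ->
  forall w a b, rotate B (w *m B) a b = L * rotate B w a b.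
Proof.
move=> Bs b01 b02 b12 b11 b22 w a b; have S i j : B i j = B j i by rewrite -{1}Bs mxE.
rewrite /rotate !bilinE !sum3 !crossE !mxE !sum3.
rewrite ?(S 1 0) ?(S 2 0) ?(S 2 1) b01 b02 b12 b11 b22; ring.
Qed.

End CrossProduct.

(** * Orthonormal frames and the Ricci form *)

(** Cholesky factorisation, by induction on the size: one step clears the first
    row and column. *)
Lemma orthonormal_frame_exists (R : realType) (m : nat) (H : 'M[R]_m) :
  H^T = H -> (forall v, v != 0 -> 0 < bilin H v v) ->
  exists F : 'M[R]_m, F *m H *m F^T = 1%:M.
Proof.
elim: m H => [|m IH] H Hs Hp; first by exists 0; apply/matrixP => -[].
rewrite -[m.+1]/(1 + m)%N in H Hs Hp * .
pose h := H 0 0; pose b := dlsubmx H : 'M[R]_(m, 1).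
have h0 : 0 < h by rewrite /h -bilin_delta; apply: Hp;
  apply/eqP => /rowP /(_ 0); rewrite !mxE /= => /eqP; rewrite oner_eq0.
have HE : H = block_mx h%:M b^T b (drsubmx H).
  rewrite -[LHS]submxK; congr block_mx.
    by apply/matrixP => i j; rewrite !ord1 !mxE /= mulr1n; congr (H _ _); apply: val_inj.
  by rewrite /b -{1}Hs -trmx_dlsub.
pose P : 'M[R]_(1 + m) := block_mx 1%:M 0 (- h^-1 *: b) 1%:M.
pose S := drsubmx H - h^-1 *: (b *m b^T).
have PHP : P *m H *m P^T = block_mx h%:M 0 0 S.
  rewrite HE /P tr_block_mx !mulmx_block !trmx1 !trmx0.
  rewrite !mul1mx !mulmx1 !mul0mx !mulmx0 !addr0.
  rewrite linearZ /= -!scalemxAl -!scalemxAr mul_mx_scalar mul_scalar_mx.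
  rewrite !scalerA !mulNr mulVf ?gt_eqF // !scaleN1r !addNr.
  by rewrite mul0mx scaler0 add0r addrC /S scaleNr.
have uP : P \in unitmx.
  by rewrite unitmxE det_lblock !det1 mulr1 unitr1.
have Sp v : v != 0 -> 0 < bilin S v v.
  move=> v0; have -> : bilin S v v = bilin H (row_mx 0 v *m P) (row_mx 0 v *m P).
    rewrite -bilin_mul PHP /bilin mul_row_block tr_row_mx mul_row_col.
    by rewrite !mul0mx !mulmx0 !add0r mul0mx add0r.
  apply: Hp; apply: contraNneq v0 => /(congr1 (mulmx^~ (invmx P))).
  by rewrite mulmxK // mul0mx => /(congr1 rsubmx); rewrite row_mxKr linear0 => ->.
have Ss : S^T = S.
  rewrite /S linearB linearZ /= trmx_mul trmxK; congr (_ - _).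
  by rewrite -[in RHS]Hs trmx_drsub.
have [F FS] := IH S Ss Sp.
exists (block_mx (Num.sqrt h)^-1%:M 0 0 F *m P).
rewrite trmx_mul !mulmxA -(mulmxA _ P) -(mulmxA _ (P *m H)) PHP.
rewrite tr_block_mx !mulmx_block !trmx0 !mul0mx !mulmx0 !addr0 !add0r !mul0mx FS tr_scalar_mx.
rewrite -!scalar_mxM mulrAC -invfM -expr2 sqr_sqrtr ?ltW // mulVf ?gt_eqF //.
by rewrite -scalar_mx_block.
Qed.

Section Frames.
Context {R : realType} {n : nat} {M : topologicalType}
  {A : smooth_manifold R n M} (g : riemannian_metric A) (c : chart A).
Local Notation U := (image_of c).
Local Notation G := (gram g c).
Local Notation curv_mx := (curv_mx g c).
Implicit Types (u v w X Y Z : 'rV[R]_n) (F : 'M[R]_n).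

Definition frame x F := F *m G x *m F^T = 1%:M.

Lemma frame_exists x : U x -> exists F, frame x F.
Proof.
by move=> Ux; apply: orthonormal_frame_exists; [exact: gram_sym|exact: gram_pos].
Qed.

Lemma frame_inv x F : frame x F -> G x *m F^T *m F = 1%:M.
Proof. by rewrite /frame -mulmxA => /mulmx1C. Qed.

Lemma frame_unit x F : frame x F -> F \in unitmx.
Proof. by move=> /frame_inv /mulmx1_unit[]. Qed.

Lemma inner_frame x F u v : frame x F -> inner g c x (u *m F) (v *m F) = (u *m v^T) 0 0.
Proof. by move=> FF; rewrite /inner -bilin_mul FF /bilin mulmx1. Qed.

Lemma innerC x u v : U x -> inner g c x u v = inner g c x v u.
Proof. by move=> Ux; rewrite /inner -bilin_tr gram_sym. Qed.

Lemma orthonormal_frame x (E : n.-tuple 'rV[R]_n) :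
  orthonormal_family g c x E <-> frame x (\matrix_i tnth E i).
Proof.
have E1 i j : ((\matrix_i tnth E i) *m G x *m (\matrix_i tnth E i)^T) i j =
    inner g c x (tnth E i) (tnth E j) by rewrite bilin_row !rowK.
split=> [oE|fE].
  apply/matrixP => i j; rewrite E1 !(tnth_nth 0) oE ?size_tuple // mxE.
  by [].
move=> i j; rewrite !size_tuple => Hi Hj.
have := congr1 (fun N : 'M[R]_n => N (Ordinal Hi) (Ordinal Hj)) fE.
by rewrite E1 !(tnth_nth 0) mxE.
Qed.

Lemma curvE x X Y Z T : U x ->
  curv g c x X Y Z T = bilin (curv_mx X Y x *m G x) Z T.
Proof. by move=> Ux; rewrite /curv curv_opE // /inner bilin_mull. Qed.

Lemma curv_anti12 x X Y Z T : U x -> curv g c x X Y Z T = - curv g c x Y X Z T.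
Proof. by move=> Ux; rewrite !curvE // curv_mx_anti mulNmx bilinNm. Qed.

Lemma curv_anti34 x X Y Z T : U x -> curv g c x X Y Z T = - curv g c x X Y T Z.
Proof.
move=> Ux; rewrite !curvE //.
have E : curv_mx X Y x *m G x = - (curv_mx X Y x *m G x)^T.
  rewrite trmx_mul gram_sym //; apply/eqP; rewrite -addr_eq0; apply/eqP.
  exact: curv_mx_skew.
by rewrite {1}E bilinNm bilin_tr.
Qed.

Lemma curv_linear1 x a X Y Z T V : U x ->
  curv g c x (a *: X + Y) Z T V = a * curv g c x X Z T V + curv g c x Y Z T V.
Proof.
move=> Ux; rewrite !curvE // curv_mx_linear // mulmxDl -scalemxAl bilinDm.
by rewrite /bilin -scalemxAr -scalemxAl mx_scaleE.
Qed.

Lemma curv_linear3 x a X Y Z T V : U x ->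
  curv g c x Z T (a *: X + Y) V = a * curv g c x Z T X V + curv g c x Z T Y V.
Proof. by move=> Ux; rewrite !curvE // bilinDl bilinZl. Qed.

Lemma curv_bianchi x X Y Z T : U x ->
  curv g c x X Y Z T + curv g c x Y Z X T + curv g c x Z X Y T = 0.
Proof.
move=> Ux; rewrite !curvE // !bilin_mull -!bilinDl curv_mx_bianchi //.
by rewrite /bilin !mul0mx mxE.
Qed.

Lemma lincomb_sum (V W : lmodType R) (f : V -> W) (r : 'rV[R]_n) (X : 'I_n -> V) :
  (forall a p q, f (a *: p + q) = a *: f p + f q) ->
  f (\sum_i r 0 i *: X i) = \sum_i r 0 i *: f (X i).
Proof.
move=> fl; have f0 : f 0 = 0 by rewrite -[0](addNr 0) -{1}scaleN1r fl scaleN1r addNr.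
apply: (big_rec2 (fun y z => f y = z)) => // i y z _ <-.
by rewrite fl.
Qed.

Lemma curv_mx_delta x X Y : U x ->
  curv_mx X Y x = \sum_k X 0 k *: curv_mx (delta_mx 0 k) Y x.
Proof.
move=> Ux; rewrite {1}[X]row_sum_delta.
by apply: (@lincomb_sum _ _ (fun Z => curv_mx Z Y x)) => *; exact: curv_mx_linear.
Qed.

(** The Ricci form, as the trace of [Z |-> R(Z, X)Y]: this expression is smooth
    in the point, unlike a choice of orthonormal frames. *)
Definition ric x : 'M[R]_n :=
  \matrix_(i, j) \sum_k curv_mx (delta_mx 0 k) (delta_mx 0 i) x j k.

Lemma smooth_ric : smooth_on U ric.
Proof.
have oU : open U by exact: chart_map_open.
apply/(smooth_mxP oU) => i j.
apply: (@smooth_eq R _ _ U oU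
   (fun x => \sum_k curv_mx (delta_mx 0 k) (delta_mx 0 i) x j k)).
  by move=> x _; rewrite mxE.
apply: smooth_sum => // k; apply: ((smooth_mxP oU _).1 _ j k).
exact: smooth_curv_mx.
Qed.

(** The trace is computed in the frame, where it is the sum over [t] of
    [R(E_t, E_i, E_j, E_t)]. *)
Lemma ric_frame x F : U x -> frame x F ->
  F *m ric x *m F^T = \matrix_(i, j) \sum_t
     curv g c x (row i F) (row t F) (row t F) (row j F).
Proof.
move=> Ux FF; apply/matrixP => a b; rewrite [RHS]mxE.
set u := row a F; set v := row b F.
transitivity (bilin (ric x) u v); first exact: bilin_row.
move: u v => u v.
(* the matrix of the endomorphism Z |-> R(Z, u)v *)
pose N : 'M[R]_n := \matrix_k (v *m curv_mx (delta_mx 0 k) u x).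
have ZN Z : Z *m N = v *m curv_mx Z u x.
  rewrite (curv_mx_delta Z u Ux).
  rewrite mulmx_sumr mulmx_sum_row; apply: eq_bigr => k _.
  by rewrite rowK scalemxAr.
transitivity (\tr N).
  rewrite bilinE /mxtrace.
  have NE k : N k k = \sum_i \sum_j u 0 i * curv_mx (delta_mx 0 k) (delta_mx 0 i) x j k * v 0 j.
    rewrite mxE curv_mx_anti (curv_mx_delta u _ Ux).
    rewrite mulmxN mulmx_sumr mx_oppE summxE -sumrN; apply: eq_bigr => i _.
    rewrite -scalemxAr mx_scaleE curv_mx_anti mulmxN mx_oppE mulrN opprK
      [(v *m _) 0 k]mxE mulr_sumr.
    by apply: eq_bigr => j _; rewrite mulrCA mulrC.
  under [RHS]eq_bigr do rewrite NE.
  rewrite [RHS]exchange_big; apply: eq_bigr => i _ /=;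
  rewrite [RHS]exchange_big; apply: eq_bigr => j _ /=.
  by rewrite [ric x i j]mxE mulr_sumr mulr_suml.
have -> : \tr N = \tr (F *m (N *m G x) *m F^T).
  have E : N *m G x *m (F^T *m F) = N.
    by rewrite -mulmxA [G x *m _]mulmxA frame_inv // mulmx1.
  by rewrite -[in LHS]E mxtrace_mulC -[F^T *m F *m _]mulmxA [LHS]mxtrace_mulC.
rewrite /mxtrace; apply: eq_bigr => t _.
rewrite curv_anti12 // curv_anti34 // opprK curvE // bilin_mull -ZN.
by rewrite bilin_row bilin_mull.
Qed.

End Frames.

(** * Operators with a simple and a double eigenvalue *)

Lemma scalar_mxE (R : pzRingType) (n : nat) (a : R) (i j : 'I_n) :
  a%:M i j = a * (i == j)%:R.
Proof. by rewrite mxE mulr_natr. Qed.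

Section AxialOperator.
Context {R : realType}.
Implicit Types (T : 'M[R]_3) (X : 'rV[R]_3).

(** [r1] is a simple eigenvalue, whose line is the axis, and [r2] a double one,
    whose eigenspace is the plane. *)
Definition axial T (r1 r2 : R) :=
  [/\ r1 != r2, (T - r1%:M) *m (T - r2%:M) = 0, \tr T = r1 + 2 * r2
    & \rank (T - r2%:M) = 1%N].

Definition traceless T : 'M[R]_3 := T - (\tr T / 3)%:M.

(** If [T] is axial, [traceless T] has eigenvalues [2m, -m, -m] and its square has
    [4m^2, m^2, m^2]: subtracting a sixth, or two thirds, of the trace [6m^2] leaves
    a multiple of the projector on the axis, or on the plane. These expressions
    are polynomial in [T], hence as smooth as [T]. *)
Definition axis_part T : 'M[R]_3 :=
  let T0 := traceless T in T0 *m T0 - (\tr (T0 *m T0) / 6)%:M.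

Definition plane_part T : 'M[R]_3 :=
  let T0 := traceless T in T0 *m T0 - (2 * \tr (T0 *m T0) / 3)%:M.

Lemma axial_parts T r1 r2 : axial T r1 r2 ->
  axis_part T = ((r2 - r1) / 3) *: (r2%:M - T) /\
  plane_part T = ((r2 - r1) / 3) *: (r1%:M - T).
Proof.
case=> _ TT trT _; set m := (r1 + 2 * r2) / 3.
have T2 : T *m T = (r1 + r2) *: T - (r1 * r2)%:M.
  apply/eqP; rewrite -subr_eq0; apply/eqP; rewrite -[RHS]TT.
  rewrite mulmxBl !mulmxBr mul_scalar_mx -scalar_mxM mul_mx_scalar.
  by apply/matrixP => i j; rewrite !mx_lincombE !scalar_mxE; ring.
have T0E : traceless T *m traceless T =
    ((r1 - r2) / 3) *: T + (m ^+ 2 - r1 * r2)%:M.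
  rewrite /traceless trT -/m mulmxBl !mulmxBr mul_scalar_mx -scalar_mxM mul_mx_scalar T2.
  apply/matrixP => i j; rewrite !mx_lincombE !scalar_mxE /m.
  by move: (T i j) (i == j)%:R => p q; field.
have trE : \tr (traceless T *m traceless T) = 2 * (r1 - r2) ^+ 2 / 3.
  rewrite T0E linearD linearZ /= mxtrace_scalar trT /m; by field.
rewrite /axis_part /plane_part /= trE T0E.
by split; apply/matrixP => i j; rewrite !mx_lincombE !scalar_mxE /m;
  move: (T i j) (i == j)%:R => p q; field.
Qed.

Lemma axial_prod T r1 r2 : axial T r1 r2 -> (r2%:M - T) *m (r1%:M - T) = 0.
Proof.
case=> _ TT _ _; rewrite -[RHS]TT !mulmxBl !mulmxBr !mul_scalar_mx !mul_mx_scalar.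
by apply/matrixP => i j; rewrite !mx_lincombE !scalar_mxE; ring.
Qed.

Lemma axial_coef r1 r2 : r1 != r2 -> (r2 - r1) / 3 != 0 :> R.
Proof.
by move=> r12; rewrite mulf_neq0 ?invr_eq0 ?pnatr_eq0 // subr_eq0 eq_sym.
Qed.

Lemma axis_eigen T r1 r2 X : axial T r1 r2 -> (X <= axis_part T)%MS -> X *m T = r1 *: X.
Proof.
move=> HT; have [-> _] := axial_parts HT.
move=> /submxP[D ->]; apply/eqP; rewrite -subr_eq0 -[r1 *: _]mul_mx_scalar -mulmxBr.
rewrite -mulmxA -scalemxAl -[T - _]opprB mulmxN axial_prod //.
by rewrite oppr0 scaler0 mulmx0.
Qed.

Lemma plane_eigen T r1 r2 X : axial T r1 r2 -> (X <= plane_part T)%MS -> X *m T = r2 *: X.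
Proof.
move=> HT; have [_ ->] := axial_parts HT; case: HT => r12 TT _ _.
move=> /submxP[D ->]; apply/eqP; rewrite -subr_eq0 -[r2 *: _]mul_mx_scalar -mulmxBr.
rewrite -mulmxA -scalemxAl -[r1%:M - T]opprB mulNmx.
by rewrite TT oppr0 scaler0 mulmx0.
Qed.

Lemma axis_rank T r1 r2 : axial T r1 r2 -> \rank (axis_part T) = 1%N.
Proof.
move=> HT; have [-> _] := axial_parts HT; case: HT => r12 _ _ rT.
by rewrite mxrank_scale_nz ?axial_coef // -opprB mxrank_opp.
Qed.

Lemma axis_plane_full T r1 r2 : axial T r1 r2 ->
  (axis_part T + plane_part T == 1%:M)%MS.
Proof.
move=> HT; have [EA EP] := axial_parts HT; case: HT => r12 _ _ _.
have k0 := axial_coef r12.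
apply/andP; split; first exact: submx1.
have -> : 1%:M = (((r2 - r1) / 3 * (r2 - r1))^-1) *: axis_part T
   - (((r2 - r1) / 3 * (r2 - r1))^-1) *: plane_part T :> 'M[R]_3.
  rewrite EA EP -scalerBr -scalerBr opprB addrA subrK -raddfB /= !scale_scalar_mx.
  by congr (_%:M); rewrite mulVf // mulf_neq0 // subr_eq0 eq_sym.
rewrite -scaleNr; apply: addmx_sub_adds; exact: scalemx_sub.
Qed.

Lemma plane_rank T r1 r2 : axial T r1 r2 -> \rank (plane_part T) = 2%N.
Proof.
move=> HT; have rA := axis_rank HT; have /eqmxP full := axis_plane_full HT.
have [EA EP] := axial_parts HT.
apply/eqP; rewrite eqn_leq; apply/andP; split.
  have AP : axis_part T *m plane_part T = 0.
    by rewrite EA EP -scalemxAl -scalemxAr axial_prod // !scaler0.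
  by have := mulmx0_rank_max AP; rewrite rA.
have := mxrank_adds_leqif (axis_part T) (plane_part T).
by rewrite full mxrank1 rA => -[].
Qed.

Lemma axis_plane_direct T r1 r2 : axial T r1 r2 ->
  mxdirect (axis_part T + plane_part T).
Proof.
move=> HT; rewrite mxdirectE /= (axis_rank HT) (plane_rank HT).
by have /eqmxP -> := axis_plane_full HT; rewrite mxrank1.
Qed.

End AxialOperator.

(** Rows forming a basis at [x] stay independent nearby: multiplied by a right
    inverse chosen at [x] they have a determinant that is 1 there, and so does
    not vanish near [x]. *)
Lemma smooth_row_basis (R : realType) (V : normedModType R) (m n q : nat)
    (U : set V) (N : V -> 'M[R]_(m, n)) x :
  open U -> smooth_on U N -> (forall y, U y -> \rank (N y) = q) -> U x ->
  exists (U' : set V) (F : 'I_q -> V -> 'rV[R]_n),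
    [/\ open U', U' x, U' `<=` U, (forall i, smooth_on U' (F i)) &
        (forall y, U' y -> (N y == \matrix_(i < q) F i y)%MS)].
Proof.
move=> oU sN rN Ux.
have [f fr] : exists f : 'I_q -> 'I_m, row_free (rowsub f (N x)).
  rewrite -(rN x Ux); exists (maxrankfun (N x)); exact: maxrowsub_free.
have /row_freeP [P NP] := fr.
pose h y := \det (rowsub f (N y) *m P).
have srow i : smooth_on U (fun y => row i (N y)).
  apply/(smooth_mxP oU) => a b.
  apply: (@smooth_eq R V R U oU (fun y => N y i b)); first by move=> y _; rewrite mxE.
  exact: (smooth_mxP oU _).1 sN i b.
have sh : smooth_on U h.
  apply: smooth_det => //; apply: smooth_mulmx => //; last exact: smooth_cst.
  apply/(smooth_mxP oU) => a b.
  apply: (@smooth_eq R V R U oU (fun y => N y (f a) b)); first by move=> y _; rewrite mxE.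
  exact: (smooth_mxP oU _).1 sN (f a) b.
have hc : {for x, continuous h}.
  by apply: differentiable_continuous; exact: smooth_differentiable sh Ux.
have hx : h x != 0 by rewrite /h NP det1 oner_eq0.
have : nbhs x [set y | U y /\ h y != 0].
  near=> y; split; first by near: y; exact: open_nbhs_nbhs.
  near: y. exact: (cvgr_neq0 (h x) hc hx).
rewrite nbhsE => -[U' [oU' U'x] U'P].
exists U', (fun i y => row (f i) (N y)); split=> //.
- by move=> y /U'P[].
- by move=> i; apply: smooth_onS (srow (f i)) => y /U'P[].
move=> y /U'P[Uy hy].
have -> : \matrix_i row (f i) (N y) = rowsub f (N y).
  by apply/row_matrixP => i; rewrite rowK row_rowsub.
have sub : (rowsub f (N y) <= N y)%MS by exact: rowsub_sub.
have rq : \rank (rowsub f (N y)) = q.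
  apply/eqP; rewrite eqn_leq rank_leq_row /=.
  apply: leq_trans (mxrankM_maxl _ P).
  by rewrite mxrank_unit // unitmxE unitfE.
rewrite sub andbT.
have := mxrank_leqif_sup sub; rewrite rq (rN y Uy) => -[_ <-]; exact: eqxx.
Unshelve. all: by end_near. Qed.

(** * The Deszcz condition at a point *)

Section Dim3.
Context {R : realType} {M : topologicalType}
  {A : smooth_manifold R 3 M} (g : riemannian_metric A) (c : chart A).
Local Notation U := (image_of c).
Local Notation G := (gram g c).
Implicit Types (u v w X Y Z a b : 'rV[R]_3) (F : 'M[R]_3).

Definition frame_curv x F u v w z :=
  curv g c x (u *m F) (v *m F) (w *m F) (z *m F).

Lemma frame_curv_like x F : U x -> curvature_like (frame_curv x F).
Proof.
move=> Ux; split=> *; rewrite /frame_curv.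
- by rewrite mulmxDl -scalemxAl curv_linear1.
- by rewrite mulmxDl -scalemxAl curv_linear3.
- exact: curv_anti12.
- exact: curv_anti34.
- exact: curv_bianchi.
Qed.

Definition sect_op x F := curvature_operator (frame_curv x F).

Lemma sect_op_sym x F : U x -> (sect_op x F)^T = sect_op x F.
Proof. by move=> Ux; exact: curvature_operator_sym (frame_curv_like F Ux). Qed.

Lemma curv_sect_op x F u v w z : U x ->
  curv g c x (u *m F) (v *m F) (w *m F) (z *m F) =
  - bilin (sect_op x F) (cross u v) (cross w z).
Proof. by move=> Ux; rewrite -(curvature_operatorE (frame_curv_like F Ux)). Qed.

Lemma ric_sect_op x F : U x -> frame g c x F ->
  F *m ric g c x *m F^T = (\tr (sect_op x F))%:M - sect_op x F.
Proof.
move=> Ux FF; rewrite (ric_frame Ux FF) -(ricci_curvature_operator (frame_curv_like F Ux)).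
apply/matrixP => i j; rewrite !mxE; apply: eq_bigr => t _.
by rewrite /frame_curv -!rowE.
Qed.

(** Inverse of [ric_sect_op], whose trace is twice that of [sect_op]. *)
Lemma sect_op_ric x F : U x -> frame g c x F ->
  sect_op x F = (\tr (F *m ric g c x *m F^T) / 2)%:M - F *m ric g c x *m F^T.
Proof.
move=> Ux FF; rewrite (ric_sect_op Ux FF) linearB /= mxtrace_scalar.
move: (sect_op x F) => B; apply/matrixP => i j.
by rewrite !mx_lincombE !scalar_mxE; field.
Qed.

Lemma ric_sym x : U x -> (ric g c x)^T = ric g c x.
Proof.
move=> Ux; have [F FF] := frame_exists g Ux; have uF := frame_unit FF.
have uFt : F^T \in unitmx by rewrite unitmx_tr.
apply: (can_inj (mulKmx uF)); apply: (can_inj (mulmxK uFt)).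
have E : (F *m ric g c x *m F^T)^T = F *m ric g c x *m F^T.
  by rewrite (ric_sect_op Ux FF) linearB /= tr_scalar_mx sect_op_sym.
by rewrite -[RHS]E !trmx_mul trmxK mulmxA.
Qed.

Lemma frame_coord x F u : frame g c x F -> exists a, u = a *m F.
Proof. by move=> /frame_unit uF; exists (u *m invmx F); rewrite mulmxKV. Qed.

Lemma act_on_curv_frame x F (Op : 'rV[R]_3 -> 'rV[R]_3) z u v w t : U x ->
  (forall a, Op (a *m F) = cross a z *m F) ->
  act_on_curv g c x Op (u *m F) (v *m F) (w *m F) (t *m F) =
  rotate (sect_op x F) z (cross u v) (cross w t).
Proof.
move=> Ux OpE; rewrite /act_on_curv !OpE !curv_sect_op // !opprK.
by rewrite /rotate -(cross_derivation u v) -(cross_derivation w t) bilinDl bilinDr addrA.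
Qed.

Lemma curv_op_frame x F u v a : U x -> frame g c x F ->
  curv_op g c x (u *m F) (v *m F) (a *m F) =
  cross a (cross u v *m sect_op x F) *m F.
Proof.
move=> Ux FF; apply: (bilin_gram_inj Ux) => w; have [b ->] := frame_coord w FF.
apply: etrans (curv_sect_op F u v a b Ux) _; apply: etrans _ (esym (inner_frame _ _ FF)).
rewrite /bilin; move: (cross u v *m _) => z.
by rewrite !dot3E !crossE; ring.
Qed.

Lemma wedge_op_frame x F u v a : U x -> frame g c x F ->
  wedge_op g c x (u *m F) (v *m F) (a *m F) = cross a (cross u v) *m F.
Proof.
by move=> Ux FF; rewrite /wedge_op !inner_frame // !scalemxAl -mulmxBl cross_cross.
Qed.

Lemma R_dot_R_frame x F v1 v2 v3 v4 u v : U x -> frame g c x F ->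
  R_dot_R g c x (v1 *m F) (v2 *m F) (v3 *m F) (v4 *m F) (u *m F) (v *m F) =
  rotate (sect_op x F) (cross u v *m sect_op x F) (cross v1 v2) (cross v3 v4).
Proof.
by move=> Ux FF; apply: act_on_curv_frame => // a; exact: curv_op_frame.
Qed.

Lemma tachibana_frame x F v1 v2 v3 v4 u v : U x -> frame g c x F ->
  tachibana g c x (v1 *m F) (v2 *m F) (v3 *m F) (v4 *m F) (u *m F) (v *m F) =
  rotate (sect_op x F) (cross u v) (cross v1 v2) (cross v3 v4).
Proof.
by move=> Ux FF; apply: act_on_curv_frame => // a; exact: wedge_op_frame.
Qed.

Lemma row3_sum u : u = u 0 0 *: delta_mx 0 0 + u 0 1 *: delta_mx 0 1 + u 0 2 *: delta_mx 0 2.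
Proof. by rewrite {1}[u]row_sum_delta sum3. Qed.

(** Two vectors orthogonal to [a], normalised by a nonzero coordinate of [a]. *)
Lemma cross_surj a : exists u v, a = cross u v.
Proof.
have [a0|a0] := eqVneq a 0.
  by exists 0, 0; rewrite a0; apply: row3P; rewrite !crossE !mxE mulr0 subr0.
have /rV0Pn[k ak] := a0.
exists (- a 0 (k + 1) *: delta_mx 0 k + a 0 k *: delta_mx 0 (k + 1)).
exists (- (a 0 (k + 2) / a 0 k) *: delta_mx 0 k + delta_mx 0 (k + 2)).
by move: k ak; apply: ord3P => ak; apply: row3P; 
  rewrite !crossE !mx_lincombE !mxE !ord3_add /=; field.
Qed.

Definition deszcz_at x L := forall V1 V2 V3 V4 X Y : 'rV[R]_3,
  R_dot_R g c x V1 V2 V3 V4 X Y = L * tachibana g c x V1 V2 V3 V4 X Y.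

Lemma deszcz_atP x F L : U x -> frame g c x F ->
  deszcz_at x L <-> (forall w a b, rotate (sect_op x F) (w *m sect_op x F) a b =
     L * rotate (sect_op x F) w a b).
Proof.
move=> Ux FF; split=> [H w a b|H V1 V2 V3 V4 X Y].
  have [w1 [w2 ->]] := cross_surj w; have [a1 [a2 ->]] := cross_surj a.
  have [b1 [b2 ->]] := cross_surj b.
  by rewrite -R_dot_R_frame // -tachibana_frame.
have [v1 ->] := frame_coord V1 FF; have [v2 ->] := frame_coord V2 FF.
have [v3 ->] := frame_coord V3 FF; have [v4 ->] := frame_coord V4 FF.
have [u ->] := frame_coord X FF; have [v ->] := frame_coord Y FF.
by rewrite R_dot_R_frame // tachibana_frame.
Qed.

(** The Ricci operator. *)
Definition ricop x : 'M[R]_3 := ric g c x *m invmx (G x).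

Lemma frame_invmx_gram x F : U x -> frame g c x F -> invmx (G x) = F^T *m F.
Proof.
move=> Ux FF; apply: (can_inj (mulKmx (gram_unit g Ux))).
by rewrite mulmxV ?gram_unit // mulmxA frame_inv.
Qed.

Lemma frame_ricop x F : U x -> frame g c x F ->
  F *m ricop x = F *m ric g c x *m F^T *m F.
Proof. by move=> Ux FF; rewrite /ricop (frame_invmx_gram Ux FF) !mulmxA. Qed.

Lemma ricop_conj x F : U x -> frame g c x F ->
  ricop x = invmx F *m (F *m ric g c x *m F^T) *m F.
Proof.
move=> Ux FF; rewrite -mulmxA -frame_ricop // mulKmx //; exact: frame_unit FF.
Qed.

Lemma tr_ricop x F : U x -> frame g c x F ->
  \tr (ricop x) = \tr (F *m ric g c x *m F^T).
Proof.
move=> Ux FF; rewrite (ricop_conj Ux FF) mxtrace_mulC mulmxA mulmxV ?mul1mx //.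
exact: frame_unit FF.
Qed.

(** With [C] the difference of the curvature operator and [L], the Ricci operator
    is [2 * L + \tr C - C] in a frame: it is a scalar if [C] is,
    and axial if [C] has rank one. *)
Lemma deszcz_at_alternative x L : U x -> deszcz_at x L ->
  (exists s, ric g c x = s *: G x) \/
  (exists2 t, t != 0 & axial (ricop x) (2 * L) (2 * L + t)).
Proof.
move=> Ux HL; have [F FF] := frame_exists g Ux; have uF := frame_unit FF.
have uFt : F^T \in unitmx by rewrite unitmx_tr.
have SE := ric_sect_op Ux FF.
have [[s Bs]|[t0 CC rC]] := rotate_alternative (sect_op_sym F Ux) ((deszcz_atP L Ux FF).1 HL).
  left; exists (2 * s).
  apply: (can_inj (mulKmx uF)); apply: (can_inj (mulmxK uFt)).
  rewrite SE Bs mxtrace_scalar -scalemxAr -scalemxAl FF scalemx1 -raddfB /=.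
  by congr (_%:M); rewrite mulrSr mulr2n; ring.
right; move: t0 CC rC; set C := _ - _; set t := \tr C => t0 CC rC.
exists t => //.
have BE : sect_op x F = C + L%:M by rewrite /C subrK.
have S2 : F *m ric g c x *m F^T = (2 * L + t)%:M - C.
  rewrite SE BE linearD /= mxtrace_scalar -/t.
  by apply/matrixP => i j; rewrite !mx_lincombE !scalar_mxE; ring.
have TE : ricop x - (2 * L + t)%:M = - (invmx F *m C *m F).
  rewrite (ricop_conj Ux FF) S2 mulmxBr mulmxBl mul_mx_scalar -scalemxAl mulVmx //.
  by rewrite scalemx1 addrAC subrr add0r.
have TE1 : ricop x - (2 * L)%:M = t%:M - invmx F *m C *m F.
  have -> : (2 * L)%:M = (2 * L + t)%:M - t%:M :> 'M[R]_3 by rewrite -raddfB /= addrK.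
  by rewrite opprB addrCA TE.
split.
- by rewrite eq_sym -subr_eq0 addrAC subrr add0r.
- rewrite TE TE1 mulmxN mulmxBl mul_scalar_mx.
  rewrite -!mulmxA (mulmxA F) mulmxV // mul1mx (mulmxA C) CC -scalemxAl -!scalemxAr.
  by rewrite subrr oppr0.
- rewrite (tr_ricop Ux FF) S2 linearB /= mxtrace_scalar -/t mulrSr mulr2n; ring.
- have full : row_full (invmx F) by rewrite row_full_unit unitmx_inv.
  by rewrite TE mxrank_opp mxrankMfree ?row_free_unit // (eqmxMfull C full).
Qed.

Lemma inner_ricop x X Y : U x -> inner g c x (X *m ricop x) Y = inner g c x X (Y *m ricop x).
Proof.
move=> Ux; have E Z T : inner g c x (Z *m ricop x) T = bilin (ric g c x) Z T.
  by rewrite /inner /bilin /ricop mulmxA mulmxKV ?gram_unit.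
by rewrite [RHS]innerC // !E -[RHS]bilin_tr ric_sym.
Qed.

Lemma eigen_orthogonal x r1 r2 X Y : U x -> r1 != r2 ->
  X *m ricop x = r1 *: X -> Y *m ricop x = r2 *: Y -> inner g c x X Y = 0.
Proof.
move=> Ux r12 XT YT; have := inner_ricop X Y Ux.
rewrite XT YT /inner bilinZl bilinZr => /eqP; rewrite -subr_eq0 -mulrBl mulf_eq0.
by rewrite subr_eq0 (negPf r12) => /eqP.
Qed.

Lemma frame3P x X Y Z : U x -> orthonormal_family g c x [:: X; Y; Z] ->
  exists2 F, frame g c x F & [/\ row 0 F = X, row 1 F = Y & row 2 F = Z].
Proof.
move=> Ux oX; exists (\matrix_i tnth [tuple X; Y; Z] i).
  by apply/orthonormal_frame.
by split; rewrite rowK (tnth_nth 0).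
Qed.

Lemma sec_frame x F a b : U x -> frame g c x F ->
  sec g c x (a *m F) (b *m F) = bilin (sect_op x F) (cross a b) (cross a b).
Proof.
move=> Ux FF; rewrite /sec curv_sect_op //.
have -> : cross b a = (-1) *: cross a b.
  by apply: row3P; rewrite !mx_scaleE !crossE; ring.
by rewrite bilinZr mulN1r opprK.
Qed.

Definition vec3 (p q r : R) : 'rV[R]_3 :=
  p *: delta_mx 0 0 + q *: delta_mx 0 1 + r *: delta_mx 0 2.

Lemma vec3E p q r : ((vec3 p q r 0 0 = p) * (vec3 p q r 0 1 = q) * (vec3 p q r 0 2 = r))%type.
Proof. by do !split; rewrite !mxE /= ?mulr1 ?mulr0 ?addr0 ?add0r. Qed.

Lemma vec3_mul p q r F : vec3 p q r *m F = p *: row 0 F + q *: row 1 F + r *: row 2 F.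
Proof. by rewrite !mulmxDl -!scalemxAl -!rowE. Qed.

(** In a frame adapted to the eigenspaces the Ricci form is diagonal, and so is
    the curvature operator. *)
Lemma axial_sec x r1 r2 X Xp Yp (cs sn : R) : U x -> axial (ricop x) r1 r2 ->
  X *m ricop x = r1 *: X -> Xp *m ricop x = r2 *: Xp -> Yp *m ricop x = r2 *: Yp ->
  orthonormal_family g c x [:: X; Xp; Yp] ->
  sec g c x (cs *: X + sn *: Xp) Yp = r1 / 2 * cs ^+ 2 + (r2 - r1 / 2) * sn ^+ 2.
Proof.
move=> Ux HT XT XpT YpT oX; have [F FF [F0 F1 F2]] := frame3P Ux oX.
pose D : 'M[R]_3 := diag_mx (vec3 r1 r2 r2).
have FT : F *m ricop x = D *m F.
  apply/row_matrixP; apply: ord3P; rewrite !row_mul row_diag_mx -scalemxAl -rowE !vec3E.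
  - by rewrite F0.
  - by rewrite F1.
  - by rewrite F2.
have SE : F *m ric g c x *m F^T = D.
  apply: (can_inj (mulmxK (frame_unit FF))).
  by rewrite -(frame_ricop Ux FF).
have BE := sect_op_ric Ux FF; rewrite SE in BE.
have -> : cs *: X + sn *: Xp = vec3 cs sn 0 *m F.
  by rewrite vec3_mul F0 F1 scale0r addr0.
have -> : Yp = vec3 0 0 1 *m F by rewrite vec3_mul F2 !scale0r !add0r scale1r.
have DE i j : D i j = vec3 r1 r2 r2 0 i * (i == j)%:R by rewrite mxE mulr_natr.
rewrite sec_frame // bilinE !sum3 !crossE !vec3E BE /mxtrace !sum3 !mx_lincombE.
by rewrite !scalar_mxE !DE !vec3E /=; field.
Qed.

(** A sectional curvature of the form [p cos^2 + q sin^2] for the angle with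
    the axis [row 0 F] leaves no off-diagonal entry in the curvature operator;
    these are detected at the angle [pi / 4] and, for the last one, on a frame
    of the plane turned by [pi / 4]. *)
Lemma sect_op_of_sec x F p q : U x -> frame g c x F ->
  (forall a b : 'rV[R]_3, a 0 0 = 0 -> b 0 0 = 0 ->
     (a *m a^T) 0 0 = 1 -> (b *m b^T) 0 0 = 1 -> (a *m b^T) 0 0 = 0 ->
     forall th : R, 0 <= th <= pi / 2 ->
     sec g c x ((cos th *: delta_mx 0 0 + sin th *: a) *m F) (b *m F) =
       p * cos th ^+ 2 + q * sin th ^+ 2) ->
  deszcz_at x p.
Proof.
move=> Ux FF H; apply/(deszcz_atP p Ux FF).
have Bs := sect_op_sym F Ux; have S i j : sect_op x F i j = sect_op x F j i by rewrite -{1}Bs mxE.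
set B := sect_op x F in Bs S *.
have pi2 : 0 <= (pi : R) / 2 by rewrite divr_ge0 // pi_ge0.
have K (a1 a2 b1 b2 : R) : 
  a1 * a1 + a2 * a2 = 1 -> b1 * b1 + b2 * b2 = 1 -> a1 * b1 + a2 * b2 = 0 ->
  forall th : R, 0 <= th <= pi / 2 ->
  let d := sin th * (a1 * b2 - a2 * b1) in
  d ^+ 2 * B 0 0 + cos th ^+ 2 * (b2 ^+ 2 * B 1 1 + b1 ^+ 2 * B 2 2 - 2 * b1 * b2 * B 1 2)
  + 2 * d * cos th * (b1 * B 0 2 - b2 * B 0 1) = p * cos th ^+ 2 + q * sin th ^+ 2.
  move=> Ea Eb Eab th Hth d.
  rewrite -(H (vec3 0 a1 a2) (vec3 0 b1 b2)) ?dot3E ?vec3E ?mul0r ?add0r //.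
  have -> : cos th *: delta_mx 0 0 + sin th *: vec3 0 a1 a2 =
      vec3 (cos th) (sin th * a1) (sin th * a2).
    by apply: row3P; rewrite !mxE /=; ring.
  rewrite sec_frame // -/B bilinE !sum3 !crossE !vec3E (S 1 0) (S 2 0) (S 2 1) /d.
  ring.
have Z0 : 0 <= (0 : R) <= pi / 2 by rewrite lexx.
have Z2 : 0 <= (pi : R) / 2 <= pi / 2 by rewrite pi2 lexx.
have Z4 : 0 <= (pi : R) / 4 <= pi / 2.
  rewrite divr_ge0 ?pi_ge0 //= ler_pM2l ?pi_gt0 // lef_pV2 ?posrE // ler_nat //.
have one : 1 * 1 + 0 * 0 = 1 :> R by rewrite mulr1 mulr0 addr0.
have one' : 0 * 0 + 1 * 1 = 1 :> R by rewrite mulr1 mulr0 add0r.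
have K1 := K 1 0 0 1 one one'; have K2 := K 0 1 1 0 one' one.
have o1 : 1 * 0 + 0 * 1 = 0 :> R by rewrite mulr0 mul0r addr0.
have o2 : 0 * 1 + 1 * 0 = 0 :> R by rewrite mulr0 mul0r addr0.
have b11 : B 1 1 = p by have := K1 o1 0 Z0; rewrite /= sin0 cos0 => E; lra.
have b22 : B 2 2 = p by have := K2 o2 0 Z0; rewrite /= sin0 cos0 => E; lra.
have b00 : B 0 0 = q by have := K1 o1 _ Z2; rewrite /= sin_pihalf cos_pihalf => E; lra.
have pi4 : 0 < (pi : R) / 4 by rewrite divr_gt0 ?pi_gt0.
have s4 : sin ((pi : R) / 4) != 0.
  rewrite gt_eqF // sin_gt0_pi // pi4 /= ltr_pdivrMr // ltr_pMr ?pi_gt0 //.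
  by rewrite ltr1n.
have c4 : cos ((pi : R) / 4) != 0.
  rewrite gt_eqF // cos_gt0_pihalf //; apply/andP; split.
    by apply: lt_trans pi4; rewrite oppr_lt0 divr_gt0 ?pi_gt0.
  by rewrite ltr_pM2l ?pi_gt0 // ltf_pV2 ?posrE // ltr_nat.
have cs4 := cos2Dsin2 ((pi : R) / 4).
have b01 : B 0 1 = 0.
  have := K1 o1 _ Z4; rewrite /= b00 b11 => E.
  apply: (mulfI s4); apply: (mulfI c4); rewrite mulr0 mulr0; lra.
have b02 : B 0 2 = 0.
  have := K2 o2 _ Z4; rewrite /= b00 b22 => E.
  apply: (mulfI s4); apply: (mulfI c4); rewrite mulr0 mulr0; lra.
have b12 : B 1 2 = 0.
  have := K (cos (pi / 4)) (sin (pi / 4)) (- sin (pi / 4)) (cos (pi / 4)).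
  move: (cos (pi / 4)) (sin (pi / 4)) cs4 s4 c4 => cs sn cs4 s4 c4 KE.
  have Ep : p * cs ^+ 2 + p * sn ^+ 2 = p by rewrite -mulrDr cs4 mulr1.
  have Ea : cs * cs + sn * sn = 1 by rewrite -!expr2.
  have Eb : - sn * - sn + cs * cs = 1 by rewrite mulrNN addrC.
  have Eab : cs * - sn + sn * cs = 0 by ring.
  have := KE Ea Eb Eab 0 Z0; rewrite /= sin0 cos0 b11 b22 => E.
  apply: (mulfI s4); apply: (mulfI c4); rewrite mulr0 mulr0; lra.
exact: rotate_axial.
Qed.

End Dim3.

(** * From points to the manifold *)

Lemma sandwich_inj (K : fieldType) (n : nat) (P X Y : 'M[K]_n) : P \in unitmx ->
  P *m X *m P^T = P *m Y *m P^T -> X = Y.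
Proof.
move=> uP; have uPt : P^T \in unitmx by rewrite unitmx_tr.
by move=> /(can_inj (mulmxK uPt)) /(can_inj (mulKmx uP)).
Qed.

Lemma ricop_transition_expr (K : fieldType) (n : nat) (G G' J S S' : 'M[K]_n) :
  G \in unitmx -> G' \in unitmx -> J \in unitmx ->
  G = J *m G' *m J^T -> S = J *m S' *m J^T ->
  S *m invmx G *m J = J *m (S' *m invmx G').
Proof.
move=> uG uG' uJ GE SE; have uJt : J^T \in unitmx by rewrite unitmx_tr.
have E : invmx G *m J *m G' *m J^T = 1%:M.
  by rewrite -!mulmxA [J *m _]mulmxA -GE mulVmx.
apply: (can_inj (mulmxK uG')); apply: (can_inj (mulmxK uJt)) => /=.
have -> : S *m invmx G *m J *m G' *m J^T = S by rewrite -[RHS]mulmx1 -E !mulmxA.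
by rewrite mulmxA mulmxKV.
Qed.

Section RicciTransition.
Context {R : realType} {M : topologicalType}
  {A : smooth_manifold R 3 M} (g : riemannian_metric A).
Implicit Types (c : chart A) (p : M).

Lemma overlap_point c c' p : chart_dom c p -> chart_dom c' p ->
  (chart_map c @` (chart_dom c `&` chart_dom c')) (chart_map c p).
Proof. by move=> pc pc'; exists p. Qed.

Lemma transition_point c c' p : chart_dom c p ->
  transition c c' (chart_map c p) = chart_map c' p.
Proof. by move=> pc; rewrite /transition /= chart_mapK. Qed.

Lemma image_point c p : chart_dom c p -> image_of c (chart_map c p).
Proof. by move=> pc; exists p. Qed.

Section TwoCharts.
Variables (c c' : chart A) (p : M) (pc : chart_dom c p) (pc' : chart_dom c' p).
Local Notation J := (jac c c' (chart_map c p)).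
Let Wp := overlap_point pc pc'.

Lemma jac_point_unit : J \in unitmx.
Proof. exact: (jac_unit g Wp). Qed.

Lemma gram_point : gram g c (chart_map c p) = J *m gram g c' (chart_map c' p) *m J^T.
Proof. by have := gram_transitionE g Wp; rewrite transition_point. Qed.

Lemma frame_transition F : frame g c (chart_map c p) F -> frame g c' (chart_map c' p) (F *m J).
Proof. by rewrite /frame gram_point trmx_mul !mulmxA. Qed.

Lemma ric_point : ric g c (chart_map c p) = J *m ric g c' (chart_map c' p) *m J^T.
Proof.
have Ux := image_point pc; have Ux' := image_point pc'.
have [F FF] := frame_exists g Ux; have FF' := frame_transition FF.
apply: (sandwich_inj (frame_unit FF)).
have E : F *m (J *m ric g c' (chart_map c' p) *m J^T) *m F^T =
   (F *m J) *m ric g c' (chart_map c' p) *m (F *m J)^T by rewrite trmx_mul !mulmxA.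
apply: etrans (ric_frame Ux FF) _; apply: etrans _ (esym E).
apply: etrans _ (esym (ric_frame Ux' FF')).
apply/matrixP => i j; rewrite !mxE; apply: eq_bigr => t _.
by rewrite (curv_transition g _ _ _ _ Wp) transition_point // !row_mul.
Qed.

Lemma ricop_point : ricop g c (chart_map c p) *m J = J *m ricop g c' (chart_map c' p).
Proof.
have Ux := image_point pc; have Ux' := image_point pc'.
exact: ricop_transition_expr (gram_unit g Ux) (gram_unit g Ux') jac_point_unit gram_point ric_point.
Qed.

Lemma tr_ricop_point : \tr (ricop g c (chart_map c p)) = \tr (ricop g c' (chart_map c' p)).
Proof.
rewrite -[in LHS](mulmxK jac_point_unit (ricop _ _ _)) ricop_point.
by rewrite mxtrace_mulC mulmxA mulVmx ?jac_point_unit // mul1mx.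
Qed.

End TwoCharts.

(** The scalar curvature does not depend on the chart, so that any choice of
    charts defines it on the manifold. *)
Definition chart_at p : chart A := projT1 (cid (chart_dom_cover A p)).

Definition scal p : R := \tr (ricop g (chart_at p) (chart_map (chart_at p) p)).

Lemma scalE c p : chart_dom c p -> \tr (ricop g c (chart_map c p)) = scal p.
Proof. by move=> pc; apply: tr_ricop_point => //; exact: projT2 (cid (chart_dom_cover A p)). Qed.

Lemma smooth_ricop c : smooth_on (image_of c) (ricop g c).
Proof.
have oU : open (image_of c) by exact: chart_map_open.
apply: smooth_mulmx => //; first exact: smooth_ric.
apply: smooth_invmx => //; first exact: gram_unit.
exact: gram_smooth.
Qed.

End RicciTransition.

Section PartsTransition.
Context {R : realType}.
Implicit Types (T J : 'M[R]_3).

Lemma tr_conj T T' J : J \in unitmx -> T *m J = J *m T' -> \tr T = \tr T'.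
Proof.
move=> uJ TJ; rewrite -(mulmxK uJ T) TJ mxtrace_mulC mulmxA mulVmx //.
by rewrite mul1mx.
Qed.

Lemma traceless_conj T T' J : J \in unitmx -> T *m J = J *m T' ->
  traceless T *m J = J *m traceless T'.
Proof.
move=> uJ TJ; rewrite /traceless (tr_conj uJ TJ) mulmxBl mulmxBr TJ.
by rewrite mul_scalar_mx mul_mx_scalar.
Qed.

Lemma parts_conj T T' J : J \in unitmx -> T *m J = J *m T' ->
  axis_part T *m J = J *m axis_part T' /\ plane_part T *m J = J *m plane_part T'.
Proof.
move=> uJ TJ; have E := traceless_conj uJ TJ.
rewrite /axis_part /plane_part /=; move: (traceless T) (traceless T') E => T0 T0' E.
have E2 : T0 *m T0 *m J = J *m (T0' *m T0') by rewrite -mulmxA E !mulmxA E.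
by rewrite (tr_conj uJ E2) !mulmxBl !mulmxBr E2 !mul_scalar_mx !mul_mx_scalar.
Qed.

Lemma submx_conj (N N' J : 'M[R]_3) (v : 'rV[R]_3) : J \in unitmx -> N *m J = J *m N' ->
  (v <= N)%MS = (v *m J <= N')%MS.
Proof.
move=> uJ E; have fJ : row_full J by rewrite row_full_unit.
by rewrite -(eqmxMfull N' fJ) -E submxMfree // row_free_unit.
Qed.

Context {V : normedModType R} (U : set V) (oU : open U).

Lemma smooth_traceless (T : V -> 'M[R]_3) :
  smooth_on U T -> smooth_on U (fun x => traceless (T x)).
Proof.
move=> sT; apply: smooth_mxB => //; apply: smooth_scalar_mx => //.
by apply: smoothM => //; [exact: smooth_mxtrace|exact: smooth_cst].
Qed.

Lemma smooth_axis_part (T : V -> 'M[R]_3) :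
  smooth_on U T -> smooth_on U (fun x => axis_part (T x)).
Proof.
move=> /smooth_traceless sT; have sTT := smooth_mulmx oU sT sT.
apply: smooth_mxB => //; apply: smooth_scalar_mx => //.
by apply: smoothM => //; [exact: smooth_mxtrace|exact: smooth_cst].
Qed.

Lemma smooth_plane_part (T : V -> 'M[R]_3) :
  smooth_on U T -> smooth_on U (fun x => plane_part (T x)).
Proof.
move=> /smooth_traceless sT; have sTT := smooth_mulmx oU sT sT.
apply: smooth_mxB => //; apply: smooth_scalar_mx => //.
apply: smoothM => //; last exact: smooth_cst.
by apply: smoothM => //; [exact: smooth_cst|exact: smooth_mxtrace].
Qed.

End PartsTransition.

Lemma bilin_wedge (R : realType) (n : nat) (G : 'M[R]_n) (k : R) (u v w z : 'rV[R]_n) :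
  bilin (k *: (G *m (v^T *m u - u^T *m v)) *m G) w z =
  k * (bilin G w v * bilin G u z - bilin G w u * bilin G v z).
Proof.
have E a b : (w *m G *m a^T *m b *m G *m z^T) 0 0 = bilin G w a * bilin G b z.
  rewrite /bilin -(mulmxA (w *m G *m a^T *m b)).
  by rewrite -(mulmxA (w *m G *m a^T)) [LHS]mxE big_ord1 !mulmxA.
by rewrite -scalemxAl bilinZm /bilin !(mulmxBr, mulmxBl) !mulmxA mx_addE mx_oppE !E.
Qed.

Section Global.
Context {R : realType} {M : topologicalType}
  {A : smooth_manifold R 3 M} (g : riemannian_metric A).
Implicit Types (c : chart A) (p : M).

(** The points where all principal Ricci curvatures agree. *)
Definition umbilic c x := exists s : R, ric g c x = s *: gram g c x.

Lemma ricci_mxE c x (E : 3.-tuple 'rV[R]_3) : image_of c x ->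
  orthonormal_family g c x E ->
  ricci_mx g c x E = (\matrix_i tnth E i) *m ric g c x *m (\matrix_i tnth E i)^T.
Proof.
move=> Ux /orthonormal_frame FF; rewrite (ric_frame Ux FF); apply/matrixP => i j.
by rewrite !mxE /ricci; apply: eq_bigr => t _; rewrite !rowK.
Qed.

(** Being umbilic is read on the multiplicities: when these are constant, all
    points are umbilic or none is. *)
Lemma umbilic_multiplicity (r : nat) (m : 'I_r -> nat) :
  (forall (c : chart A) (p : M) (E : 3.-tuple 'rV[R]_3),
    chart_dom c p -> orthonormal_family g c (chart_map c p) E ->
    exists lam : 'I_r -> R,
      [/\ injective lam,
          (forall t, eigenvalue (ricci_mx g c (chart_map c p) E) t <->
                     exists a, t = lam a) &
          (forall a,
             \rank (eigenspace (ricci_mx g c (chart_map c p) E) (lam a)) = m a)]) ->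
  forall c p, chart_dom c p ->
    umbilic c (chart_map c p) <-> exists a, m a = 3%N.
Proof.
move=> Hm c p pc; have Ux := image_point pc.
have [F FF] := frame_exists g Ux.
pose E := [tuple row i F | i < 3].
have FE : \matrix_i tnth E i = F by apply/row_matrixP => i; rewrite rowK tnth_mktuple.
have oE : orthonormal_family g c (chart_map c p) E by apply/orthonormal_frame; rewrite FE.
have [lam [_ Hl Hr]] := Hm c p E pc oE.
have SE := ricci_mxE Ux oE; rewrite FE in SE.
split=> [[s Hs]|[a ma]].
  have Ss : ricci_mx g c (chart_map c p) E = s%:M.
    by rewrite SE Hs -scalemxAr -scalemxAl FF scalemx1.
  have K : \rank (eigenspace (ricci_mx g c (chart_map c p) E) s) = 3%N.
    by rewrite /eigenspace Ss subrr mxrank_ker mxrank0.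
  have /Hl [a sa] : eigenvalue (ricci_mx g c (chart_map c p) E) s.
    by rewrite /eigenvalue -mxrank_eq0 K.
  by exists a; rewrite -Hr -sa.
exists (lam a).
have /eqP := Hr a; rewrite ma /eigenspace mxrank_ker => /eqP r0.
have /eqP : \rank (ricci_mx g c (chart_map c p) E - (lam a)%:M) = 0%N.
  have := rank_leq_row (ricci_mx g c (chart_map c p) E - (lam a)%:M).
  by move: r0; case: (\rank _) => [|[|[|[|k]]]].
rewrite mxrank_eq0 subr_eq0 SE => /eqP ES.
apply: (sandwich_inj (frame_unit FF)).
by rewrite ES -scalemxAr -scalemxAl FF scalemx1.
Qed.

Lemma umbilic_curv_mx c x u v : image_of c x -> umbilic c x ->
  curv_mx g c u v x =
  (\tr (ricop g c x) / 6) *: (gram g c x *m (v^T *m u - u^T *m v)).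
Proof.
move=> Ux [s Hs]; have [F FF] := frame_exists g Ux.
have uG := gram_unit g Ux.
have -> : \tr (ricop g c x) / 6 = s / 2.
  rewrite /ricop Hs -scalemxAl mulmxV // linearZ /= mxtrace1; by field.
have SE : F *m ric g c x *m F^T = s%:M by rewrite Hs -scalemxAr -scalemxAl FF scalemx1.
have BE : sect_op g c x F = (s / 2)%:M.
  rewrite (sect_op_ric Ux FF) SE mxtrace_scalar -raddfB /=.
  by congr (_%:M); field.
apply: (can_inj (mulmxK uG)); apply: bilin_inj => w z.
rewrite -curvE //.
rewrite bilin_wedge -![bilin (gram g c x) _ _]/(inner g c x _ _).
have [a ->] := frame_coord u FF; have [b ->] := frame_coord v FF.
have [d ->] := frame_coord w FF; have [e ->] := frame_coord z FF.
rewrite curv_sect_op // BE !inner_frame //.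
have -> y y' : bilin (s / 2)%:M y y' = s / 2 * (y *m y'^T) 0 0.
  by rewrite /bilin mul_mx_scalar -scalemxAl mx_scaleE.
by rewrite !dot3E !crossE; ring.
Qed.

Section Umbilic.
Hypothesis umb : forall c p, chart_dom c p -> umbilic c (chart_map c p).

Let umbU c x : image_of c x -> umbilic c x.
Proof. by case=> p pc <-; exact: umb. Qed.

(** Schur's lemma: the tensor [dk /\ X /\ Y] of [schur_bianchi] is tested on the
    coordinate vectors, the entry [(i + 2, i + 1)] isolating [D_i k]. *)
Lemma derive_scal_eq0 c x v : image_of c x ->
  'D_v (fun y => \tr (ricop g c y) / 6) x = 0.
Proof.
move=> Ux; set k := fun y => _.
have oU : open (image_of c) by exact: chart_map_open.
have sk : smooth_on (image_of c) k.
  apply: smoothM => //; last exact: smooth_cst.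
  by apply: smooth_mxtrace => //; exact: smooth_ricop.
have dk : differentiable k x by exact: smooth_differentiable sk Ux.
have kE y : image_of c y -> forall u v,
    curv_mx g c u v y = k y *: (gram g c y *m (v^T *m u - u^T *m v)).
  by move=> Uy u w; apply: umbilic_curv_mx => //; exact: umbU.
have De i : 'D_(delta_mx 0 i) k x = 0.
  have := schur_bianchi (delta_mx 0 i) (delta_mx 0 (i + 1)) (delta_mx 0 (i + 2)) Ux dk kE.
  move=> /matrixP /(_ (i + 2) (i + 1)).
  move: ('D_(delta_mx 0 i) k x) ('D_(delta_mx 0 (i + 1)) k x)
    ('D_(delta_mx 0 (i + 2)) k x) => p q r.
  rewrite !trmx_delta !mul_delta_mx !mx_lincombE !mxE.
  by move: i; apply: ord3P; rewrite !ord3_add /= !(mulr0, mulr1, subr0, addr0, add0r, subrr).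
rewrite derive_lincomb //; apply: big1 => i _.
by rewrite De scaler0.
Qed.

Lemma scal_locally_constant p : \forall q \near p, scal g q = scal g p.
Proof.
have [c pc] := chart_dom_cover A p.
have oU : open (image_of c) by exact: chart_map_open.
have Ux := image_point pc.
have : nbhs (chart_map c p) (image_of c) by exact: open_nbhs_nbhs.
move=> /nbhs_ballP [d /= d0 BU].
pose k y : R := \tr (ricop g c y) / 6.
have sk : smooth_on (image_of c) k.
  apply: smoothM => //; last exact: smooth_cst.
  by apply: smooth_mxtrace => //; exact: smooth_ricop.
have kc := @locally_constant_of_derive0 R _ k (chart_map c p) d
  (fun y By => smooth_differentiable sk (BU y By))
  (fun y v By => derive_scal_eq0 v (BU y By)).
near=> q.
have qc : chart_dom c q.
  by near: q; apply: open_nbhs_nbhs; split=> //; exact: chart_dom_open.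
have Bq : ball (chart_map c p) d (chart_map c q).
  near: q; apply: (chart_map_continuous pc); exact: nbhsx_ballx.
have := kc _ Bq; rewrite /k (scalE g pc) (scalE g qc) => /mulIf; apply.
by rewrite invr_eq0 pnatr_eq0.
Unshelve. all: by end_near. Qed.

Lemma umbilic_real_space_form : connected [set: M] -> real_space_form g.
Proof.
move=> hconn.
have [[p0 _]|noM] := pselect (exists p : M, True); last first.
  by exists 0 => c p; case: noM; exists p.
have const q : scal g q = scal g p0.
  have : [set q | scal g q = scal g p0] = [set: M].
    apply: hconn; first by exists p0.
      exists [set q | scal g q = scal g p0]; last by rewrite setTI.
      rewrite openE => p /= Hp; have := scal_locally_constant p.
      by apply: filterS => q' /= ->.
    exists [set q | scal g q = scal g p0]; last by rewrite setTI.
    rewrite -openC openE => p /= Hp; have := scal_locally_constant p.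
    by apply: filterS => q' /= ->.
  by move=> /seteqP[_ /(_ q)]; apply.
exists (scal g p0 / 6) => c p pc v w ov.
have Ux := image_point pc.
have vv : inner g c (chart_map c p) v v = 1 by have := ov 0%N 0%N erefl erefl.
have ww : inner g c (chart_map c p) w w = 1 by have := ov 1%N 1%N erefl erefl.
have wv : inner g c (chart_map c p) w v = 0 by have := ov 1%N 0%N erefl erefl.
rewrite /sec curvE // umbilic_curv_mx //; last exact: umbU.
rewrite bilin_wedge -![bilin _ _ _]/(inner g c (chart_map c p) _ _).
by rewrite vv ww wv mul0r subr0 !mulr1 (scalE g pc) const.
Qed.

End Umbilic.

Section Axial.
Variable L : M -> R.
Hypothesis ax : forall c p, chart_dom c p ->
  axial (ricop g c (chart_map c p)) (2 * L p) (scal g p / 2 - L p).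

Let axU c x : image_of c x -> exists r1 r2, axial (ricop g c x) r1 r2.
Proof. by case=> p pc <-; exists (2 * L p), (scal g p / 2 - L p); exact: ax. Qed.

Section Fibres.
Variables (part : 'M[R]_3 -> 'M[R]_3) (q : nat).
Hypothesis part_conj : forall T T' J, J \in unitmx -> T *m J = J *m T' ->
  part T *m J = J *m part T'.
Hypothesis part_rank : forall T r1 r2, axial T r1 r2 -> \rank (part T) = q.
Hypothesis part_smooth : forall (U : set 'rV[R]_3) T, open U ->
  smooth_on U T -> smooth_on U (fun x => part (T x)).

(** A construction of subspaces from the Ricci operator is a distribution as soon
    as it commutes with conjugation, by which the Ricci operator changes chart. *)
Program Definition part_distribution : smooth_distribution A q :=
  {| fibre := fun c x => part (ricop g c x) |}.
Next Obligation.
move=> c x Ux; have [r1 [r2 H]] := axU Ux; exact: part_rank H.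
Qed.
Next Obligation.
move=> c c' p pc pc' v; rewrite (diff_transition _ (overlap_point pc pc')).
apply: submx_conj; first exact: jac_point_unit.
by apply: part_conj; [exact: jac_point_unit|exact: ricop_point].
Qed.
Next Obligation.
move=> c x Ux; have oU : open (image_of c) by exact: chart_map_open.
apply: smooth_row_basis => //.
  by apply: part_smooth => //; exact: smooth_ricop.
by move=> y Uy; have [r1 [r2 H]] := axU Uy; exact: part_rank H.
Qed.

End Fibres.

Definition axis_distribution : smooth_distribution A 1 :=
  @part_distribution axis_part 1 (fun T T' J uJ E => (parts_conj uJ E).1)
    (fun T r1 r2 H => axis_rank H) (fun U T oU sT => smooth_axis_part oU sT).

Definition plane_distribution : smooth_distribution A 2 :=
  @part_distribution plane_part 2 (fun T T' J uJ E => (parts_conj uJ E).2)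
    (fun T r1 r2 H => plane_rank H) (fun U T oU sT => smooth_plane_part oU sT).

Lemma axial_quasi_space_form : quasi_space_form g.
Proof.
exists axis_distribution, plane_distribution, L, (fun p => scal g p / 2 - 2 * L p).
split=> [p|c p pc|c p pc X Y HX HY|c p pc X Xp Yp HX HXp HYp oX th _].
- have [c pc] := chart_dom_cover A p; have [r12 _ _ _] := ax pc.
  by apply: contraNneq r12 => E; apply/eqP; lra.
- by split; [exact: axis_plane_direct (ax pc)|exact: axis_plane_full (ax pc)].
- have [r12 _ _ _] := ax pc.
  apply: (eigen_orthogonal (image_point pc) r12).
    exact: axis_eigen (ax pc) HX.
  exact: plane_eigen (ax pc) HY.
rewrite (axial_sec _ _ (image_point pc) (ax pc) (axis_eigen (ax pc) HX)
   (plane_eigen (ax pc) HXp) (plane_eigen (ax pc) HYp) oX).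
by field.
Qed.

End Axial.

Lemma polar_dot (a b : 'rV[R]_3) (th : R) : a 0 0 = 0 -> b 0 0 = 0 ->
  (a *m a^T) 0 0 = 1 -> (a *m b^T) 0 0 = 0 ->
  let v := cos th *: delta_mx 0 0 + sin th *: a in
  [/\ (v *m v^T) 0 0 = 1, (v *m b^T) 0 0 = 0 & (b *m v^T) 0 0 = 0].
Proof.
move=> a0 b0 aa ab v.
have v0 : v 0 0 = cos th by rewrite !mxE /= a0; ring.
have v1 : v 0 1 = sin th * a 0 1 by rewrite !mxE /=; ring.
have v2 : v 0 2 = sin th * a 0 2 by rewrite !mxE /=; ring.
move: aa ab; rewrite !dot3E v0 v1 v2 a0 b0 => aa ab.
split.
- rewrite -(cos2Dsin2 th) -[in RHS](mulr1 (sin th ^+ 2)) -aa; ring.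
- transitivity (sin th * (0 * 0 + a 0 1 * b 0 1 + a 0 2 * b 0 2)); first by ring.
  by rewrite ab mulr0.
- transitivity (sin th * (0 * 0 + a 0 1 * b 0 1 + a 0 2 * b 0 2)); first by ring.
  by rewrite ab mulr0.
Qed.

Lemma deszcz_of_real_space_form : real_space_form g -> deszcz_symmetric g.
Proof.
case=> k Hk; exists (fun=> k) => c p pc; have Ux := image_point pc.
have [F FF] := frame_exists g Ux.
apply: (sect_op_of_sec Ux FF (q := k)) => a b a0 b0 aa bb ab th _.
rewrite -mulrDr cos2Dsin2 mulr1; apply: (Hk c p pc).
set v := cos th *: delta_mx 0 0 + sin th *: a.
have [vv vb bv] := polar_dot th a0 b0 aa ab.
by move=> [|[|//]] [|[|//]] _ _ /=; rewrite inner_frame.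
Qed.

Lemma subspace_frame c x (m q : nat) (N : 'M[R]_(m, 3)) : image_of c x -> \rank N = q ->
  exists2 B : 'M[R]_(q, 3), B *m gram g c x *m B^T = 1%:M & (B <= N)%MS.
Proof.
move=> Ux <-.
have [B0 fB sB] : exists2 B0 : 'M[R]_(\rank N, 3), row_free B0 & (B0 <= N)%MS.
  by exists (row_base N); rewrite ?eq_row_base // row_base_free.
pose H := B0 *m gram g c x *m B0^T.
have [||F FH] := @orthonormal_frame_exists R _ H.
- by rewrite /H !trmx_mul trmxK (gram_sym g Ux) mulmxA.
- move=> v v0; have -> : bilin H v v = bilin (gram g c x) (v *m B0) (v *m B0).
    by rewrite /bilin /H trmx_mul !mulmxA.
  apply: gram_pos => //; apply: contraNneq v0 => vB.
  have /row_freeP[P BP] := fB.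
  by rewrite -[v]mulmx1 -BP mulmxA vB mul0mx.
exists (F *m B0); first by rewrite trmx_mul -FH /H !mulmxA.
by apply: submx_trans (submxMl _ _) _.
Qed.

Lemma deszcz_of_quasi_space_form : quasi_space_form g -> deszcz_symmetric g.
Proof.
case=> D [Dp [Kbar [Kperp [_ _ orth Hsec]]]]; exists Kbar => c p pc.
have Ux := image_point pc.
have [B1 O1 S1] := subspace_frame Ux (fibre_rank D Ux).
have [B2 O2 S2] := subspace_frame Ux (fibre_rank Dp Ux).
have XD : (row 0 B1 <= fibre D c (chart_map c p))%MS by apply: submx_trans S1; exact: row_sub.
have XpD : (row 0 B2 <= fibre Dp c (chart_map c p))%MS by apply: submx_trans S2; exact: row_sub.
have YpD : (row 1 B2 <= fibre Dp c (chart_map c p))%MS by apply: submx_trans S2; exact: row_sub.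
have XX : inner g c (chart_map c p) (row 0 B1) (row 0 B1) = 1 by rewrite /inner -bilin_row O1 mxE.
have P2 i j : inner g c (chart_map c p) (row i B2) (row j B2) = (i == j)%:R.
  by rewrite /inner -bilin_row O2 mxE.
have XP i : inner g c (chart_map c p) (row 0 B1) (row i B2) = 0.
  by apply: orth => //; apply: submx_trans S2; exact: row_sub.
have oX : orthonormal_family g c (chart_map c p) [:: row 0 B1; row 0 B2; row 1 B2].
  move=> [|[|[|//]]] [|[|[|//]]] _ _ /=; rewrite ?XX ?P2 ?XP //; by rewrite innerC // XP.
have [F FF [F0 F1 F2]] := frame3P Ux oX.
apply: (sect_op_of_sec Ux FF (q := Kperp p)) => a b a0 b0 aa bb ab th Hth.
have inDp (d : 'rV[R]_3) : d 0 0 = 0 -> (d *m F <= fibre Dp c (chart_map c p))%MS.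
  move=> d0; rewrite [d]row3_sum d0 scale0r add0r mulmxDl -!scalemxAl -!rowE F1 F2.
  by apply: addmx_sub; apply: scalemx_sub.
have -> : (cos th *: delta_mx 0 0 + sin th *: a) *m F = cos th *: row 0 B1 + sin th *: (a *m F).
  by rewrite mulmxDl -!scalemxAl -rowE F0.
apply: (Hsec c p pc (row 0 B1) (a *m F) (b *m F) XD (inDp a a0) (inDp b b0) _ th Hth).
have ba : (b *m a^T) 0 0 = 0 by rewrite -ab !dot3E; ring.
have Xd (d : 'rV[R]_3) : d 0 0 = 0 -> inner g c (chart_map c p) (row 0 B1) (d *m F) = 0.
  move=> d0; rewrite -F0 rowE inner_frame // dot3E d0 !mxE /=; ring.
by move=> [|[|[|//]]] [|[|[|//]]] _ _ /=; rewrite ?XX ?Xd ?inner_frame //;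
  rewrite innerC ?Xd.
Qed.

End Global.

Theorem theorem3 (R : realType) (M : topologicalType)
    (A : smooth_manifold R 3 M) (g : riemannian_metric A)
    (hconn : connected [set: M]%classic)
    (hmult : constant_ricci_multiplicities g) :
  deszcz_symmetric g <-> real_space_form g \/ quasi_space_form g.
Proof.
split; last first.
  by case; [exact: deszcz_of_real_space_form|exact: deszcz_of_quasi_space_form].
case=> L HL; case: hmult => r [m Hm].
have umb := umbilic_multiplicity Hm.
have [m3|no3] := pselect (exists a, m a = 3%N).
  left; apply: umbilic_real_space_form => // c p pc.
  exact/(umb c p pc).
right; apply: (@axial_quasi_space_form _ _ _ g L) => c p pc.
have Ux := image_point pc.
case: (deszcz_at_alternative Ux (HL c p pc)) => [us|[t t0 H]].
  by case: no3; apply/(umb c p pc).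
have E : \tr (ricop g c (chart_map c p)) = 2 * L p + 2 * (2 * L p + t) by case: H.
rewrite (scalE g pc) in E.
by have -> : scal g p / 2 - L p = 2 * L p + t by rewrite E; field.
Qed.
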